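(* Let $H$ and $K$ be complex Hilbert spaces, let $\mathcal{A}=\mathcal{L}(H,K\times H)$ and put $$\mathcal{D}=\{Z\in\mathcal{A}: Z_1^*Z_1<Z_2^*Z_2,\ Z_2^{-1}\text{ exists}\},$$ where $Z=\begin{bmatrix}Z_1\\Z_2\end{bmatrix}$ with $Z_1\in\mathcal{L}(H,K)$ and $Z_2\in\mathcal{L}(H)$. Then $\mathcal{D}$ is symmetric and the group of linear biholomorphic mappings of $\mathcal{D}$ acts transitively on $\mathcal{D}$. Moreover, $\mathcal{D}$ is holomorphically equivalent to the product domain $\mathcal{D}'=\mathcal{L}(H,K)_0\times G\mathcal{L}(H)$, where $G\mathcal{L}(H)$ is the set of all invertible operators in $\mathcal{L}(H)$.
   Context: $\mathcal{L}(H,K)$ is the Banach space of bounded linear operators from $H$ to $K$ with the operator norm, $\mathcal{L}(H)=\mathcal{L}(H,H)$, and $\mathcal{L}(H,K)_0$ is the open unit ball of $\mathcal{L}(H,K)$. $K\times H$ is the Hilbert space direct sum. For self-adjoint operators, $S<T$ means that $T-S$ is positive and invertible. Holomorphic means complex Fréchet differentiable; a biholomorphic mapping is a holomorphic bijection with holomorphic inverse, and two domains are holomorphically equivalent if there is a biholomorphic mapping of one onto the other. The linear biholomorphic mappings of $\mathcal{D}$ are the biholomorphic mappings of $\mathcal{D}$ onto itself which are restrictions of bounded linear maps of $\mathcal{A}$ into itself. A domain is symmetric if for each of its points $Y$ there is a biholomorphic mapping $s$ of the domain onto itself with $s\circ s=\mathrm{id}$, $s(Y)=Y$ and Fréchet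 derivative $Ds(Y)=-I$. *)

(* Defs.v *)
From HB Require Import structures.
From mathcomp Require Import all_boot all_order all_algebra.
From mathcomp Require Import complex.
From mathcomp Require Import boolp classical_sets functions reals topology.
From mathcomp Require Import normedtype derive.

Set Implicit Arguments.
Unset Strict Implicit.
Unset Printing Implicit Defensive.

Import Order.TTheory GRing.Theory Num.Theory.
Import numFieldNormedType.Exports.

Local Open Scope ring_scope.
Local Open Scope classical_set_scope.
Local Open Scope complex_scope.

(* The inner product is linear in its first argument and conjugate linear in
   the second one. *)
HB.mixin Record CompleteNormedModule_isHilbert (R : realType) V
    & CompleteNormedModule R[i] V := {
  inner : {dot V for (@Num.conj R[i])};
  inner_norm : forall x, inner x x = `|x| ^+ 2
}.

#[short(type="hilbertType")]
HB.structure Definition Hilbert (R : realType) :=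
  {V of CompleteNormedModule R[i] V & CompleteNormedModule_isHilbert R V}.

Section DotNorm.
Variables (C : numClosedFieldType) (U : lmodType C).
Variable f : {dot U for (@Num.conj C)}.

Lemma dot_residual u v : v != 0 ->
  let w := u - (f u v / f v v) *: v in
  f w w = f u u - `|f u v| ^+ 2 / f v v.
Proof.
move=> v0; have vgt0 : 0 < f v v by exact: neq0_dnorm_gt0.
set c := f u v / f v v; rewrite /= dnormB dnormZ linearZr_LR /=.
have cE : f u v = c * f v v by rewrite mulfVK// gt_eqF.
have nE : `|f u v| ^+ 2 / f v v = `|c| ^+ 2 * f v v.
  rewrite cE normrM (gtr0_norm vgt0) exprMn [f v v ^+ 2]expr2.
  by rewrite !mulrA mulfK ?gt_eqF.
have -> : c^* * f u v = `|c| ^+ 2 * f v v.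
  by rewrite cE mulrA normCK [c^* * c]mulrC.
rewrite nE.
set t := _ * f v v; have tr : t \is Num.real.
  by rewrite realM ?rpredX ?normr_real ?gtr0_real.
by rewrite (CrealP tr) opprD addrA addrK.
Qed.

Lemma dot_CauchySchwarz u v : `|f u v| ^+ 2 <= f u u * f v v.
Proof.
have [->|v0] := eqVneq v 0; first by rewrite !linear0r normr0 expr0n.
have vgt0 : 0 < f v v by exact: neq0_dnorm_gt0.
by rewrite -ler_pdivrMr// -subr_ge0 -dot_residual// dnorm_ge0.
Qed.

Lemma dot_triangle u v :
  sqrtC (f (u + v) (u + v)) <= sqrtC (f u u) + sqrtC (f v v).
Proof.
rewrite -[leRHS]sqrCK ?addr_ge0 ?sqrtC_ge0 ?dnorm_ge0//.
rewrite ler_sqrtC ?qualifE/= ?dnorm_ge0 ?exprn_ge0 ?addr_ge0 ?sqrtC_ge0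
  ?dnorm_ge0//.
rewrite dnormD sqrrD !sqrtCK addrAC lerD2r lerD2l.
have dr : f u v + (f u v)^* \is Num.real.
  by apply/CrealP; rewrite rmorphD/= conjCK addrC.
apply: le_trans (real_ler_norm dr) _; apply: le_trans (ler_normD _ _) _.
rewrite norm_conjC -mulr2n lerMn2r/= -[leLHS]sqrCK ?normr_ge0//.
rewrite -sqrtCM ?nnegrE ?dnorm_ge0// ler_sqrtC ?qualifE/= ?mulr_ge0 ?exprn_ge0
  ?dnorm_ge0//.
exact: dot_CauchySchwarz.
Qed.

End DotNorm.

Section InnerTheory.
Variables (R : realType) (V : hilbertType R).
Implicit Types (a : R[i]) (x y z : V).

Lemma innerPl a x y z : inner (a *: x + y) z = a * inner x z + inner y z.
Proof. by rewrite linearPl. Qed.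

Lemma innerPr a x y z :
  inner z (a *: x + y) = a^*%R * inner z x + inner z y.
Proof. by rewrite linearPr. Qed.

Lemma innerC x y : inner x y = (inner y x)^*%R.
Proof. by rewrite hermC expr0 mul1r. Qed.

End InnerTheory.

(* The Hilbert space direct sum needs a copy of the product type: the canonical
   norm of [U * V] is the maximum of the norms of the components. *)
Definition dsum (R : realType) (U V : hilbertType R) : Type := (U * V)%type.

Section DirectSum.
Variables (R : realType) (U V : hilbertType R).
Local Notation W := (dsum U V).

HB.instance Definition _ := GRing.Lmodule.copy W (U * V)%type.

Definition dsum_inner (u v : W) : R[i] := inner u.1 v.1 + inner u.2 v.2.

Lemma dsum_inner_bilinear :
  bilinear_for *%R (@Num.conj R[i] \; *%R) dsum_inner.
Proof.
split=> [w a u v|w a u v]; rewrite /dsum_inner/=.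
  by rewrite !innerPl mulrDr addrACA.
by rewrite !innerPr mulrDr addrACA.
Qed.

HB.instance Definition _ := @bilinear_isBilinear.Build R[i] W W R[i]
  *%R (@Num.conj R[i] \; *%R) dsum_inner dsum_inner_bilinear.

Lemma dsum_inner_hermitian u v :
  dsum_inner u v = (-1) ^+ false * (dsum_inner v u)^*%R.
Proof.
by rewrite expr0 mul1r rmorphD/= -!innerC.
Qed.

HB.instance Definition _ := @isHermitianSesquilinear.Build R[i] W
  false (@Num.conj R[i]) dsum_inner dsum_inner_hermitian.

Lemma dsum_inner_gt0 u : u != 0 -> 0 < dsum_inner u u.
Proof.
move=> u0; rewrite /dsum_inner !inner_norm.
rewrite lt_def addr_ge0 ?exprn_ge0// andbT paddr_eq0 ?exprn_ge0//.
rewrite !expf_eq0/= !normr_eq0; apply: contra u0 => /andP[/eqP u1 /eqP u2].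
by apply/eqP; case: u u1 u2 => ? ? /= -> ->.
Qed.

HB.instance Definition _ := @isDotProduct.Build R[i] W
  dsum_inner dsum_inner_gt0.

Definition dsum_norm (u : W) : R[i] := sqrtC (`|u.1| ^+ 2 + `|u.2| ^+ 2).

Lemma dsum_normE u : dsum_norm u = sqrtC (dsum_inner u u).
Proof. by rewrite /dsum_norm /dsum_inner !inner_norm. Qed.

Lemma ler_dsum_normD u v : dsum_norm (u + v) <= dsum_norm u + dsum_norm v.
Proof. by rewrite !dsum_normE; exact: dot_triangle. Qed.

Lemma dsum_normZ (a : R[i]) u : dsum_norm (a *: u) = `|a| * dsum_norm u.
Proof.
by rewrite !dsum_normE dnormZ sqrtCM ?nnegrE ?exprn_ge0 ?dnorm_ge0// sqrCK.
Qed.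

Lemma dsum_norm0_eq0 u : dsum_norm u = 0 -> u = 0.
Proof. by rewrite dsum_normE => /eqP; rewrite sqrt_dnorm_eq0 => /eqP. Qed.

HB.instance Definition _ :=
  Lmodule_isNormed.Build R[i] W ler_dsum_normD dsum_normZ dsum_norm0_eq0.

Lemma dsum_fst_le u : `|u.1| <= `|u : W|.
Proof.
rewrite -[leLHS]sqrCK// ler_sqrtC ?qualifE/= ?addr_ge0 ?exprn_ge0//.
by rewrite lerDl exprn_ge0.
Qed.

Lemma dsum_snd_le u : `|u.2| <= `|u : W|.
Proof.
rewrite -[leLHS]sqrCK// ler_sqrtC ?qualifE/= ?addr_ge0 ?exprn_ge0//.
by rewrite lerDr exprn_ge0.
Qed.

Lemma dsum_norm_le u : `|u : W| <= `|u.1| + `|u.2|.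
Proof.
rewrite -[leRHS]sqrCK ?addr_ge0// ler_sqrtC ?qualifE/= ?addr_ge0 ?exprn_ge0
  ?addr_ge0//.
by rewrite sqrrD addrAC lerDl mulrn_wge0 ?mulr_ge0.
Qed.

Lemma dsum_complete (F : set_system W) : ProperFilter F -> cauchy F -> cvg F.
Proof.
move=> FF /(@cauchyP R[i]) Fc.
have c1 : cvg (fst @ F).
  apply: cauchy_cvg; apply: (@cauchy_exP R[i]) => e /Fc[x Fx]; exists x.1.
  suff : ball x e `<=` fst @^-1` ball x.1 e by move=> /filterS; exact.
  move=> y; rewrite -!ball_normE/=.
  by apply: le_lt_trans; exact: (dsum_fst_le (x - y)).
have c2 : cvg (snd @ F).
  apply: cauchy_cvg; apply: (@cauchy_exP R[i]) => e /Fc[x Fx]; exists x.2.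
  suff : ball x e `<=` snd @^-1` ball x.2 e by move=> /filterS; exact.
  move=> y; rewrite -!ball_normE/=.
  by apply: le_lt_trans; exact: (dsum_snd_le (x - y)).
apply/cvg_ex; exists ((lim (fst @ F), lim (snd @ F)) : W).
apply/cvgrPdist_lt => e e0; have e20 : 0 < e / 2 by rewrite divr_gt0.
move/cvgrPdist_lt : c1 => /(_ (e / 2) e20) c1.
move/cvgrPdist_lt : c2 => /(_ (e / 2) e20) c2.
apply: filterS2 c1 c2 => x /= x1 x2; rewrite [e]splitr.
by apply: le_lt_trans (dsum_norm_le _) _; exact: ltrD.
Qed.

HB.instance Definition _ := Uniform_isComplete.Build W dsum_complete.

Lemma dsum_inner_norm u : dsum_inner u u = `|u : W| ^+ 2.
Proof. by rewrite [`|u|]dsum_normE sqrtCK. Qed.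

HB.instance Definition _ := CompleteNormedModule_isHilbert.Build R W
  dsum_inner_norm.

End DirectSum.

Section BoundedOperators.
Variables (R : realType) (V W : normedModType R[i]).

Definition bounded_linear : {pred V -> W} := fun f =>
  `[< linear f /\ exists M : R[i], forall x, `|f x| <= M * `|x| >].

Record bop := Bop { bop_fun :> V -> W ; bopP : bop_fun \in bounded_linear }.

HB.instance Definition _ := [isSub for bop_fun].
HB.instance Definition _ := [Choice of bop by <:].

Lemma bounded_linear_submod_closed : submod_closed bounded_linear.
Proof.
split=> [|a f g].
  apply/asboolP; split=> [a u v|].
    by change (0 = a *: (0 : W) + 0); rewrite scaler0 addr0.
  by exists 0 => x; change (`|0 : W| <= 0 * `|x|); rewrite mul0r normr0.
move=> /asboolP[fl [M fM]] /asboolP[gl [N gN]]; apply/asboolP; split=> [b u v|].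
  change (a *: f (b *: u + v) + g (b *: u + v) =
          b *: (a *: f u + g u) + (a *: f v + g v)).
  by rewrite fl gl !scalerDr !scalerA [a * b]mulrC addrACA.
exists (`|a| * M + N) => x; change (`|a *: f x + g x| <= (`|a| * M + N) * `|x|).
rewrite (le_trans (ler_normD _ _))// mulrDl.
by rewrite lerD// normrZ -mulrA ler_wpM2l.
Qed.

HB.instance Definition _ :=
  GRing.isSubmodClosed.Build R[i] (V -> W) bounded_linear
    bounded_linear_submod_closed.
HB.instance Definition _ := [SubChoice_isSubLmodule of bop by <:].

Lemma bop_linear (T : bop) : linear T.
Proof. by have /asboolP[] := bopP T. Qed.

HB.instance Definition _ (T : bop) :=
  GRing.isLinear.Build R[i] V W *:%R T (bop_linear T).

(* Norms take their values in [R[i]], suprema exist in [R]. *)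
Definition opnorm (T : bop) : R[i] :=
  (sup [set complex.Re `|T x| | x in [set x : V | `|x| <= 1]])%:C.

Lemma bop_bounded (T : bop) :
  exists2 M : R[i], 0 <= M & forall x, `|T x| <= M * `|x|.
Proof.
have /asboolP[_ [M TM]] := bopP T; exists `|M|; first exact: normr_ge0.
move=> x; have TMx := TM x; rewrite (le_trans TMx)//.
rewrite -{2}[`|x|]normr_id -normrM ger0_norm//.
exact: le_trans (normr_ge0 _) TMx.
Qed.

Lemma opnorm_has_sup (T : bop) :
  has_sup [set complex.Re `|T x| | x in [set x : V | `|x| <= 1]].
Proof.
split.
  by exists (complex.Re `|T 0|); exists 0 => //=; rewrite normr0 ler01.
have [M M0 TM] := bop_bounded T; exists (complex.Re M) => _ [x /= x1 <-].
rewrite -lecR !RRe_real ?ger0_real ?normr_ge0// (le_trans (TM x))//.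
by rewrite -[leRHS]mulr1 ler_wpM2l.
Qed.

Lemma opnorm_ub (T : bop) x : `|x| <= 1 -> `|T x| <= opnorm T.
Proof.
move=> x1; rewrite -[leLHS]RRe_real ?normr_real// /opnorm lecR.
by apply: sup_upper_bound; [exact: opnorm_has_sup|exists x].
Qed.

Lemma opnorm_lub (T : bop) (M : R[i]) :
  (forall x, `|x| <= 1 -> `|T x| <= M) -> opnorm T <= M.
Proof.
move=> TM; have M0 : 0 <= M by rewrite (le_trans _ (TM 0 _)) ?normr0 ?ler01.
rewrite -[M]RRe_real ?ger0_real// /opnorm lecR.
apply: ge_sup; first by have [] := opnorm_has_sup T.
move=> _ [x /= x1 <-]; rewrite -lecR !RRe_real ?ger0_real//; exact: TM.
Qed.

Lemma opnorm_ge0 (T : bop) : 0 <= opnorm T.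
Proof. by rewrite (le_trans _ (@opnorm_ub T 0 _)) ?normr0 ?ler01. Qed.

Lemma ler_opnorm (T : bop) x : `|T x| <= opnorm T * `|x|.
Proof.
have [->|x0] := eqVneq x 0; first by rewrite linear0 !normr0 mulr0.
have nx : 0 < `|x| by rewrite normr_gt0.
rewrite -ler_pdivrMr// mulrC.
have <- : `|T (`|x|^-1 *: x)| = `|x|^-1 * `|T x|.
  by rewrite linearZ/= normrZ normfV normr_id.
by apply: opnorm_ub; rewrite normrZ normfV normr_id mulVf ?gt_eqF.
Qed.

Lemma ler_opnormD (S T : bop) : opnorm (S + T) <= opnorm S + opnorm T.
Proof.
apply: opnorm_lub => x x1; rewrite (le_trans (ler_normD _ _))// lerD//;
exact: opnorm_ub.
Qed.

Lemma opnormZ (a : R[i]) (T : bop) : opnorm (a *: T) = `|a| * opnorm T.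
Proof.
have le (b : R[i]) (S : bop) : opnorm (b *: S) <= `|b| * opnorm S.
  apply: opnorm_lub => x x1; rewrite [`|_|]normrZ ler_wpM2l//.
  exact: opnorm_ub.
apply/eqP; rewrite eq_le le/=; have [->|a0] := eqVneq a 0.
  by rewrite normr0 mul0r opnorm_ge0.
rewrite -ler_pdivlMl ?normr_gt0// -normfV.
by rewrite -{1}[T](scalerK a0); exact: le.
Qed.

Lemma bop_ext (S T : bop) : (forall x, S x = T x) -> S = T.
Proof. by move=> ST; apply: val_inj; apply/funext. Qed.

Lemma opnorm0_eq0 (T : bop) : opnorm T = 0 -> T = 0.
Proof.
move=> T0; apply: bop_ext => x; apply/eqP.
by rewrite -[_ == _]normr_le0 (le_trans (ler_opnorm T x))// T0 mul0r.
Qed.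

HB.instance Definition _ :=
  Lmodule_isNormed.Build R[i] bop ler_opnormD opnormZ opnorm0_eq0.

End BoundedOperators.


Section OperatorAlgebra.
Variables (R : realType) (U V W : normedModType R[i]).

Lemma bop_comp_subproof (S : bop V W) (T : bop U V) :
  S \o T \in @bounded_linear R U W.
Proof.
apply/asboolP; split=> [a u v|]; first by rewrite /= !linearP.
have [M M0 SM] := bop_bounded S; have [N N0 TN] := bop_bounded T.
exists (M * N) => x; rewrite (le_trans (SM _))// -mulrA ler_wpM2l//.
Qed.

Definition bop_comp (S : bop V W) (T : bop U V) : bop U W :=
  Bop (bop_comp_subproof S T).

Lemma bop_id_subproof : id \in @bounded_linear R U U.
Proof. by apply/asboolP; split=> //; exists 1 => x; rewrite mul1r. Qed.

Definition bop_id : bop U U := Bop bop_id_subproof.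

End OperatorAlgebra.

Section Projections.
Variables (R : realType) (U V : hilbertType R).

Lemma dsum_fst_subproof : fst \in @bounded_linear R (dsum U V) U.
Proof.
apply/asboolP; split=> //; exists 1 => x; rewrite mul1r; exact: dsum_fst_le.
Qed.

Lemma dsum_snd_subproof : snd \in @bounded_linear R (dsum U V) V.
Proof.
apply/asboolP; split=> //; exists 1 => x; rewrite mul1r; exact: dsum_snd_le.
Qed.

Definition dsum_fst : bop (dsum U V) U := Bop dsum_fst_subproof.
Definition dsum_snd : bop (dsum U V) V := Bop dsum_snd_subproof.

End Projections.

Section Riesz.
Variables (R : realType) (H : hilbertType R).

Lemma ler_inner (x y : H) : `|inner x y| <= `|x| * `|y|.
Proof.
have := dot_CauchySchwarz (@inner R H) x y.
rewrite !inner_norm -exprMn.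
by rewrite ler_pXn2r ?nnegrE ?mulr_ge0.
Qed.

Lemma parallelogram (x y : H) :
  `|x - y| ^+ 2 + `|x + y| ^+ 2 = (`|x| ^+ 2 + `|y| ^+ 2) *+ 2.
Proof.
by rewrite -!inner_norm dnormB dnormD addrACA addNr addr0 -mulr2n.
Qed.

Variables (phi : {linear H -> R[i] | *%R}) (M : R[i]).
Hypothesis phiM : forall x, `|phi x| <= M * `|x|.

Lemma riesz_representation : exists z, forall x, phi x = inner x z.
Proof.
have [phi0|/existsNP[v0 /eqP phiv0]] := pselect (forall x, phi x = 0).
  by exists 0 => x; rewrite phi0 linear0r.
pose v := (phi v0)^-1 *: v0.
have phiv : phi v = 1 by rewrite linearZ/= mulVf.
pose A := [set complex.Re (`|x| ^+ 2) | x in [set x : H | phi x = 1]].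
pose m := (inf A)%:C.
have Ainf : has_inf A.
  split; first by exists (complex.Re (`|v| ^+ 2)); exists v.
  exists 0 => _ [x _ <-]; rewrite -lecR RRe_real ?exprn_ge0//.
  by rewrite ger0_real// exprn_ge0.
have sqr_real (x : H) : `|x| ^+ 2 \is Num.real.
  by rewrite ger0_real// exprn_ge0.
have m_lb x : phi x = 1 -> m <= `|x| ^+ 2.
  move=> px; rewrite -[leRHS]RRe_real// lecR.
  by apply: (inf_lbound Ainf.2); exists x.
have m_adh (e : R[i]) : 0 < e -> exists2 x, phi x = 1 & `|x| ^+ 2 < m + e.
  move=> e0; have e0' : 0 < complex.Re e by rewrite -ltcR RRe_real ?gtr0_real.
  have [_ [x px <-] xe] := inf_adherent e0' Ainf; exists x => //.
  rewrite -[ltLHS]RRe_real// -[e]RRe_real ?gtr0_real// -rmorphD/= ltcR.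
  exact: xe.
pose B (e : R[i]) := [set x : H | phi x = 1 /\ `|x| ^+ 2 < m + e].
pose F := filter_from [set e : R[i] | 0 < e] B.
have FF : ProperFilter F.
  apply: filter_from_proper; last first.
    by move=> e /= /m_adh[x px xm]; exists x.
  apply: filter_from_filter; first by exists 1 => /=; exact: ltr01.
  move=> d e /= d0 e0; have de : d >=< e by rewrite real_comparable ?gtr0_real.
  exists (Num.min d e) => /=.
    by rewrite comparable_lt_min ?d0.
  move=> x [px]; rewrite -ltrBlDl comparable_lt_min// => /andP[xd xe].
  by split; split=> //; rewrite -ltrBlDl.
have B_close e x y : B e x -> B e y -> `|x - y| ^+ 2 <= e *+ 4.
  move=> [px xe] [py ye].
  have xy : m *+ 4 <= `|x + y| ^+ 2.
    have p1 : phi (2^-1 *: (x + y)) = 1.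
      by rewrite linearZ/= linearD/= px py -mulr2n mulVf ?pnatr_eq0.
    have := m_lb _ p1.
    rewrite normrZ exprMn normfV normr_nat exprVn ler_pdivlMl ?exprn_gt0//.
    by rewrite -natrX mulr_natl.
  have := parallelogram x y; move=> /(canRL (addrK _)) ->.
  rewrite lerBlDr; apply: (@le_trans _ _ ((m + e + (m + e)) *+ 2)).
    by rewrite lerMn2r/= lerD// ltW.
  by rewrite -mulr2n -mulrnA mulrnDl addrC lerD2l.
have /cvg_ex[u Fu] : cvg F.
  apply: cauchy_cvg; apply: (@cauchy_exP R[i]) => e e0.
  have e8 : 0 < e ^+ 2 / 8 by rewrite divr_gt0 ?exprn_gt0.
  have [x px xm] := m_adh _ e8; exists x; exists (e ^+ 2 / 8) => //= y By.
  rewrite -ball_normE/= -(@ltr_pXn2r _ 2) ?nnegrE ?(ltW e0)//.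
  apply: le_lt_trans (B_close _ x y _ By) _ => //.
  rewrite -[ltLHS]mulr_natr -mulrA gtr_pMr ?exprn_gt0// mulrC.
  by rewrite ltr_pdivrMr ?ltr0n// mul1r ltr_nat.
have u_close (e : R[i]) : 0 < e -> exists2 x, B e x & `|u - x| < e.
  move=> e0; have Fe : F (B e) by exists e.
  have Fb : F (ball u e) by apply: Fu; exact: nbhsx_ballx.
  have [x [Bx]] := filter_ex (filterI Fe Fb).
  by rewrite -ball_normE; exists x.
have M0 : 0 <= M.
  have : 0 < `|v|.
    rewrite normr_gt0; apply: contra_eq_neq phiv => ->.
    by rewrite linear0 eq_sym oner_eq0.
  move=> v_gt0; rewrite -(pmulr_lge0 _ v_gt0).
  exact: le_trans (normr_ge0 _) (phiM v).
have small (x y k : R[i]) : 0 <= k ->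
    (forall e, 0 < e -> e < 1 -> x <= y + k * e) -> x <= y.
  move=> k0 xy; apply/ler_addgt0Pr => d d0.
  have k1 : 0 < k + 1 by rewrite ltr_wpDl ?ltr01.
  have d1 : 1 < 1 + d by rewrite ltrDl.
  have q0 : 0 < (k + 1) * (1 + d) by rewrite mulr_gt0// (lt_trans _ d1).
  have dq : (k + 1) * d < (k + 1) * (1 + d) by rewrite ltr_pM2l// ltrDr.
  have kq : k * d <= d * ((k + 1) * (1 + d)).
    rewrite [leLHS]mulrC ler_pM2l// (@le_trans _ _ (k + 1)) ?lerDl//.
    by rewrite -[leLHS]mulr1 ler_pM2l// ltW.
  apply: le_trans (xy (d / ((k + 1) * (1 + d))) _ _) _.
  - by rewrite divr_gt0.
  - rewrite ltr_pdivrMr// mul1r (le_lt_trans _ dq)//.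
    by rewrite -[leLHS]mul1r ler_pM2r// lerDr.
  - by rewrite lerD2l mulrA ler_pdivrMr.
have phiu : phi u = 1.
  apply/eqP; rewrite -subr_eq0 -normr_le0; apply: (small _ _ M) => // e e0 _.
  have [x [px _] xu] := u_close _ e0.
  by rewrite add0r -px -linearB/= (le_trans (phiM _))// ler_wpM2l// ltW.
have m0 : 0 <= m.
  rewrite /m lecR; apply: lb_le_inf; first exact: Ainf.1.
  by move=> _ [x _ <-]; rewrite -lecR RRe_real// exprn_ge0.
have um : `|u| ^+ 2 <= m.
  apply: (small _ _ (1 + (m + 2) *+ 2 + 1)) => [|e e0 e1].
    by rewrite !addr_ge0 ?mulrn_wge0 ?addr_ge0.
  have [x [px xm] xu] := u_close _ e0.
  have xm2 : `|x| <= m + 2.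
    have /orP[x1|x1] := real_leVge (normr_real x) (@real1 R[i]).
      by rewrite (le_trans x1)// -[leLHS]add0r lerD// ler1n.
    rewrite (@le_trans _ _ (`|x| ^+ 2))//.
      by rewrite expr2 -[leLHS]mulr1 ler_wpM2l.
    rewrite (le_trans (ltW xm))// lerD2l (le_trans (ltW e1))// ler1n//.
  have ux : `|u| <= `|x| + e.
    by rewrite -[u](subrK x) addrC (le_trans (ler_normD _ _))// lerD2l ltW.
  have : `|u| ^+ 2 <= (`|x| + e) ^+ 2.
    by rewrite ler_pXn2r ?nnegrE ?addr_ge0 ?(ltW e0).
  move=> /le_trans; apply; rewrite sqrrD.
  have xe : `|x| * e <= (m + 2) * e by rewrite ler_pM2r.
  have ee : e ^+ 2 <= e by rewrite expr2 -[leRHS]mulr1 ler_pM2l// ltW.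
  move: (m + 2) xe => k xe.
  rewrite [(_ + 1) * e]mulrDl [(1 + _) * e]mulrDl mul1r mulrnAl !addrA.
  by do 3![apply: lerD => //]; exact: ltW.
have orth w : phi w = 0 -> inner w u = 0.
  move=> pw; have [->|w0] := eqVneq w 0; first by rewrite linear0l.
  have wgt0 : 0 < inner w w by exact: neq0_dnorm_gt0.
  have := dot_residual (@inner R H) u w0; rewrite /= !inner_norm => E.
  have := m_lb (u - (inner u w / `|w| ^+ 2) *: w).
  rewrite linearB linearZ/= pw mulr0 subr0 => /(_ phiu).
  rewrite E => mu.
  have : `|inner u w| ^+ 2 / inner w w <= 0.
    rewrite inner_norm.
    move: mu; rewrite lerBrDr => /le_trans/(_ um).
    by rewrite gerDl.
  rewrite pmulr_lle0 ?invr_gt0// => uw0.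
  have : `|inner u w| ^+ 2 == 0 by rewrite eq_le uw0 exprn_ge0.
  by rewrite expf_eq0/= normr_eq0 => /eqP uw; rewrite innerC uw conjC0.
have u0 : u != 0.
  by apply: contra_eq_neq phiu => ->; rewrite linear0 eq_sym oner_eq0.
have nu : 0 < inner u u by exact: neq0_dnorm_gt0.
exists ((inner u u)^-1 *: u) => x.
have : inner (x - phi x *: u) u = 0.
  by apply: orth; rewrite linearB linearZ/= phiu mulr1 subrr.
rewrite linearBl/= linearZl_LR/= linearZr_LR/= => /eqP.
rewrite subr_eq0 => /eqP ->.
rewrite fmorphV/= (CrealP (gtr0_real nu)).
by rewrite mulrCA mulVf ?mulr1// gt_eqF.
Qed.

End Riesz.

Section Adjoint.
Variables (R : realType) (H K : hilbertType R).
Implicit Types T : bop H K.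

Definition adjoint_form T (y : K) : H -> R[i] := fun x => inner (T x) y.

Lemma adjoint_form_linear T y : linear_for *%R (adjoint_form T y).
Proof. by move=> a u v; rewrite /adjoint_form linearP innerPl. Qed.

HB.instance Definition _ T y := GRing.isLinear.Build R[i] H R[i] *%R
  (adjoint_form T y) (adjoint_form_linear T y).

Lemma adjoint_exists T :
  exists S : bop K H, forall x y, inner (T x) y = inner x (S y).
Proof.
have /choice[S TS] : forall y, exists z, forall x, inner (T x) y = inner x z.
  move=> y.
  apply: (@riesz_representation _ _ (adjoint_form T y) (`|T| * `|y|)) => x.
  by rewrite (le_trans (ler_inner _ _))// mulrAC ler_wpM2r// ler_opnorm.
have S_bounded : S \in @bounded_linear R K H.
  apply/asboolP; split=> [a u v|].
    apply/eqP; rewrite -subr_eq0 -(dnorm_eq0 (@inner R H)); apply/eqP.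
    set w := (X in inner X _ = 0).
    by rewrite linearBr/= innerPr -!TS innerPr subrr.
  exists `|T| => y; have [->|Sy0] := eqVneq (S y) 0.
    by rewrite normr0 mulr_ge0.
  have Sy : 0 < `|S y| by rewrite normr_gt0.
  rewrite -(ler_pM2r Sy) -expr2 -inner_norm -TS.
  rewrite (le_trans (real_ler_norm _))//.
    by rewrite TS inner_norm realX ?normr_real.
  rewrite (le_trans (ler_inner _ _))// mulrAC ler_wpM2r//.
  exact: ler_opnorm.
by exists (Bop S_bounded) => x y; exact: TS.
Qed.

Definition adjoint T : bop K H := projT1 (cid (adjoint_exists T)).

Lemma adjointP T x y : inner (T x) y = inner x (adjoint T y).
Proof. by rewrite /adjoint; case: cid => S /=; exact. Qed.

End Adjoint.

Section OperatorOrder.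
Variables (R : realType) (H : hilbertType R).
Implicit Types S T : bop H H.

Definition invertible_bop T :=
  exists S, bop_comp S T = bop_id H /\ bop_comp T S = bop_id H.

(* For [z : R[i]], [0 <= z] means that [z] is real and nonnegative, so
   that a positive operator is self-adjoint. *)
Definition positive_bop T := forall x, 0 <= inner (T x) x.

Definition bop_lt S T := positive_bop (T - S) /\ invertible_bop (T - S).

End OperatorOrder.

Definition domain (R : realType) (V : normedModType R[i]) (D : set V) :=
  [/\ D !=set0, open D & connected D].

(* A mapping on an open set [D] is represented by a total function whose values
   outside [D] are irrelevant, since differentiability at a point of [D] only
   depends on the values in a neighborhood of that point. The scalars being
   [R[i]], the differential is complex linear. *)
Definition holomorphic (R : realType) (V W : normedModType R[i])
    (D : set V) (f : V -> W) :=
  forall x, D x -> differentiable f x.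

Definition biholomorphic (R : realType) (V W : normedModType R[i])
    (D : set V) (E : set W) (f : V -> W) :=
  [/\ holomorphic D f, set_bij D E f
    & exists g : W -> V, holomorphic E g /\ forall x, D x -> g (f x) = x].

Definition holomorphically_equivalent (R : realType) (V W : normedModType R[i])
    (D : set V) (E : set W) :=
  [/\ domain D, domain E & exists f : V -> W, biholomorphic D E f].

Section Automorphisms.
Variables (R : realType) (V : normedModType R[i]).
Implicit Types (D : set V) (f : V -> V).

Definition linear_biholomorphic D f :=
  biholomorphic D D f /\ exists L : bop V V, forall x, D x -> f x = L x.

Definition linearly_transitive D :=
  forall Y Z, D Y -> D Z -> exists f, linear_biholomorphic D f /\ f Y = Z.

Definition symmetric_domain D :=
  domain D /\
  forall Y, D Y -> exists s : V -> V,
    [/\ biholomorphic D D s, forall x, D x -> s (s x) = x, s Y = Y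
      & forall h, 'd s Y h = - h].

End Automorphisms.

Section Domains.
Variables (R : realType) (H K : hilbertType R).

Definition domainD : set (bop H (dsum K H)) := [set Z |
  let Z1 := bop_comp (dsum_fst K H) Z in
  let Z2 := bop_comp (dsum_snd K H) Z in
  bop_lt (bop_comp (adjoint Z1) Z1) (bop_comp (adjoint Z2) Z2)
  /\ invertible_bop Z2].

Definition open_unit_ball : set (bop H K) := [set T | `|T| < 1].

Definition general_linear : set (bop H H) := [set T | invertible_bop T].

Definition domainD' : set (bop H K * bop H H) :=
  open_unit_ball `*` general_linear.

End Domains.

Arguments domainD {R} H K.
Arguments open_unit_ball {R} H K.
Arguments general_linear {R} H.
Arguments domainD' {R} H K.

(* Main.v *)
Require Import Defs.
From HB Require Import structures.
From mathcomp Require Import all_boot all_order all_algebra.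
From mathcomp Require Import complex.
From mathcomp Require Import boolp classical_sets functions reals topology.
From mathcomp Require Import interval_inference.
From mathcomp Require Import sequences normedtype derive landau.
From mathcomp Require Import ring lra.

(** Dividing the upper row of [Z] by the lower one, [Z |-> (Z1 Z2^-1, Z2)],
    turns the condition [Z1^* Z1 < Z2^* Z2] into [|Z1 Z2^-1| < 1]: a positive
    invertible operator is bounded below, so the strict inequality is uniform.
    This map and its inverse [(W, T) |-> (W T, T)] are holomorphic, which gives
    the equivalence with the product domain ([biholomorphic_to_product]). That
    both sides are domains requires the invertible operators to be open and
    connected.

    Most existence statements rest on one fact, [accretive_invertible]: an
    operator whose real part is bounded below by a positive constant is
    invertible. It also shows that the segment from the identity to an
    invertible operator with nonnegative real part consists of invertible
    operators. Hence [general_linear_connected] follows once every invertible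
    [T] is a product of such factors. With a positive scalar that makes [T] a
    contraction, the polar decomposition gives [T = U S] with [S] a square root
    ([square_root_exists]) and [U] unitary. If [B] is the imaginary part of [U]
    and [F] is a symmetry that commutes with [U] and has [F B >= 0]
    ([sign_exists]), then [U = (i F) ((i F)^-1 U)]; the first factor has real
    part [0] and the second has real part [F B]. The symmetry [F] is [2 P - 1]
    for the projection [P] on the kernel of [|B| - B], which is a strong limit
    of powers ([fixed_projection]).

    For transitivity, let [X] be the self-adjoint operator with off-diagonal
    entries [B] and [B^*], where [|B| < 1]. Since [X] anticommutes with the
    grading, its Cayley transform [M = (1 + X) (1 - X)^-1] preserves
    [|z2| ^ 2 - |z1| ^ 2], so the mappings [Z |-> M Z T] with [T] invertible
    preserve the domain ([cayley_domain], [right_mul_domain]). The point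
    [(0, 1)] is sent to a point over [W = 2 B (1 + B^* B)^-1], an equation that
    a square root solves for [B] ([half_angle]), and [T] adjusts the lower row
    ([transitive_from_base]).

    Finally [(W, T) |-> (- W, T^-1)] is an involution of the product domain that
    fixes [(0, 1)] with derivative [- 1] there; it is transported to the domain,
    and conjugated by linear automorphisms to the other points. *)

Set Implicit Arguments.
Unset Strict Implicit.
Unset Printing Implicit Defensive.

Import Order.TTheory GRing.Theory Num.Theory.
Import numFieldNormedType.Exports.

Local Open Scope ring_scope.
Local Open Scope classical_set_scope.
Local Open Scope complex_scope.

(** * Real norms, convergence and bounded operators *)

Notation "S \co T" := (bop_comp S T) (at level 40, left associativity).

Section RealParts.
Variable R : realType.
Implicit Types (a : R) (z w : R[i]).

Lemma ReD z w : @complex.Re R (z + w) = @complex.Re R z + @complex.Re R w.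
Proof. by case: z w => [? ?] [? ?]. Qed.

Lemma ReN z : @complex.Re R (- z) = - @complex.Re R z.
Proof. by case: z. Qed.

Lemma ReZ a z : @complex.Re R (a%:C * z) = a * @complex.Re R z.
Proof. by case: z => u v /=; rewrite mul0r subr0. Qed.

Lemma Re_conj z : @complex.Re R (z^*)%R = @complex.Re R z.
Proof. by case: z. Qed.

End RealParts.

Section RealNorm.
Variables (R : realType) (V : normedModType R[i]).
Implicit Types (x y : V) (a : R).

(** The norms of the modules over [R[i]] lie in [R[i]], which is only partially
    ordered; all estimates are carried out on their real parts. *)
Definition rnorm x : R := @complex.Re R `|x|.

Lemma rnormE x : `|x| = (rnorm x)%:C.
Proof. by rewrite RRe_real// normr_real. Qed.

Lemma rnorm_ge0 x : 0 <= rnorm x.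
Proof. by rewrite -ler0c -rnormE. Qed.

Lemma rnorm_le (M : R) x : (rnorm x <= M) = (`|x| <= M%:C).
Proof. by rewrite rnormE lecR. Qed.

Lemma rnorm_lt (M : R) x : (rnorm x < M) = (`|x| < M%:C).
Proof. by rewrite rnormE ltcR. Qed.

Lemma rnormD x y : rnorm (x + y) <= rnorm x + rnorm y.
Proof. by rewrite rnorm_le rmorphD/= -!rnormE ler_normD. Qed.

Lemma rnormN x : rnorm (- x) = rnorm x.
Proof. by rewrite /rnorm normrN. Qed.

Lemma rnormB x y : rnorm (x - y) <= rnorm x + rnorm y.
Proof. by rewrite -[rnorm y]rnormN rnormD. Qed.

Lemma rdistC x y : rnorm (x - y) = rnorm (y - x).
Proof. by rewrite -rnormN opprB. Qed.

Lemma rnorm0 : rnorm 0 = 0.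
Proof. by rewrite /rnorm normr0. Qed.

Lemma rnorm_eq0 x : (rnorm x == 0) = (x == 0).
Proof. by rewrite -[x == 0]normr_eq0 rnormE; apply/eqP/eqP => [->|[]]. Qed.

Lemma rnorm_normZ (z : R[i]) x : rnorm (z *: x) = @complex.Re R `|z| * rnorm x.
Proof.
by rewrite /rnorm normrZ -ReZ RRe_real ?normr_real.
Qed.

Lemma Re_norm_real a : @complex.Re R `|a%:C| = `|a|.
Proof. by rewrite normc_def /= expr0n /= addr0 sqrtr_sqr. Qed.

Lemma rnormZ a x : rnorm (a%:C *: x) = `|a| * rnorm x.
Proof. by rewrite rnorm_normZ Re_norm_real. Qed.

(** Positive elements of [R[i]] are real, so real radii describe the same
    neighborhoods. *)
Lemma nbhs_rnormP x (P : set V) :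
  nbhs x P <-> exists2 e : R, 0 < e & forall y, rnorm (y - x) < e -> P y.
Proof.
split=> [/nbhs_ballP[e e0 eP]|[e e0 eP]].
  exists (complex.Re e).
    by rewrite -ltcR RRe_real ?gtr0_real.
  move=> y; rewrite rnorm_lt RRe_real ?gtr0_real// => xy; apply: eP.
  by rewrite -ball_normE /= distrC.
apply/nbhs_ballP; exists e%:C => /=; first by rewrite ltcR.
by move=> y; rewrite -ball_normE/= distrC -rnorm_lt => /eP.
Qed.

Lemma cvg_rnormP (T : Type) (F : set_system T) {FF : Filter F} (f : T -> V) x :
  f @ F --> x <-> forall e : R, 0 < e -> F [set t | rnorm (f t - x) < e].
Proof.
split=> [fx e e0|fx A /nbhs_rnormP[e e0 eA]].
  have := fx [set y | rnorm (y - x) < e]; apply.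
  by apply/nbhs_rnormP; exists e.
by apply: filterS (fx e e0) => t; exact: eA.
Qed.

Lemma rnorm_cvg (T : Type) (F : set_system T) {FF : Filter F} (f : T -> V) x :
  f @ F --> x -> rnorm (f t) @[t --> F] --> rnorm x.
Proof.
move=> /cvg_rnormP fx; apply/cvgrPdist_lt => e e0.
apply: filterS (fx e e0) => t /=; apply: le_lt_trans.
rewrite ler_norml; apply/andP; split.
  have := rnormD (f t - x) x; rewrite subrK; lra.
by have := rnormD (x - f t) (f t); rewrite subrK rdistC; lra.
Qed.

End RealNorm.

Section Completeness.
Variables (R : realType) (V : completeNormedModType R[i]).

(** The increments of a bounded monotone real sequence are eventually
    arbitrarily small, hence so are the distances that they dominate. *)
Lemma cvg_of_increments (u : nat -> V) (a : nat -> R) (M : R) k :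
  (forall n, a n <= M) ->
  (forall n m, (n <= m)%N -> rnorm (u m - u n) ^+ k.+1 <= a m - a n) ->
  exists l : V, u n @[n --> \oo] --> l.
Proof.
move=> aM ua; apply/cvg_ex.
apply: cauchy_cvg; apply: (@cauchy_exP R[i]) => e e0.
have [r re] : exists r : R, e = r%:C.
  by apply/complex_realP; rewrite gtr0_real.
have r0 : 0 < r by rewrite -ltcR -re.
have as_ : has_sup (range a).
  by split; [exists (a 0%N); exists 0%N|exists M => _ [n _ <-]].
have [_ [N _ <-] aN] := sup_adherent (exprn_gt0 k.+1 r0) as_.
exists (u N); exists N => // m /= Nm.
rewrite -ball_normE/= distrC re -rnorm_lt.
rewrite -(@ltr_pXn2r _ k.+1) ?nnegrE ?rnorm_ge0 ?(ltW r0)//.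
apply: le_lt_trans (ua _ _ Nm) _.
have : a m <= sup (range a) by apply: ub_le_sup; [case: as_|exists m].
by move: aN; lra.
Qed.

Lemma cvg_of_steps (u : nat -> V) (y : nat -> R) (M : R) :
  (forall n, y n <= M) ->
  (forall n, rnorm (u n.+1 - u n) <= y n.+1 - y n) ->
  exists l : V, u n @[n --> \oo] --> l.
Proof.
move=> yM uy; apply: (@cvg_of_increments u y M 0) => // n m.
rewrite expr1; elim: m => [|m IHm].
  by rewrite leqn0 => /eqP ->; rewrite !subrr rnorm0.
rewrite leq_eqVlt => /predU1P[->|/IHm um]; first by rewrite !subrr rnorm0.
have := rnormD (u m.+1 - u m) (u m - u n).
rewrite addrA subrK => /le_trans; apply.
by have := uy m; move: um; lra.
Qed.

End Completeness.

Section BopNorm.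
Variables (R : realType) (U V W : normedModType R[i]).

Lemma bopD (S T : bop U V) x : (S + T) x = S x + T x. Proof. by []. Qed.
Lemma bopN (T : bop U V) x : (- T) x = - T x. Proof. by []. Qed.
Lemma bopB (S T : bop U V) x : (S - T) x = S x - T x. Proof. by []. Qed.
Lemma bopZ a (T : bop U V) x : (a *: T) x = a *: T x. Proof. by []. Qed.
Lemma bop0 x : (0 : bop U V) x = 0. Proof. by []. Qed.
Lemma bopC (S : bop V W) (T : bop U V) x : (S \co T) x = S (T x).
Proof. by []. Qed.
Lemma bop1 (x : U) : bop_id U x = x. Proof. by []. Qed.

Lemma bopK (T : bop U V) x : rnorm (T x) <= rnorm T * rnorm x.
Proof. by rewrite rnorm_le rmorphM/= -!rnormE; exact: ler_opnorm. Qed.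

Lemma rnorm_bop_le (T : bop U V) (M : R) : 0 <= M ->
  (forall x, rnorm (T x) <= M * rnorm x) -> rnorm T <= M.
Proof.
move=> M0 TM; rewrite rnorm_le; apply: opnorm_lub => x x1.
rewrite -rnorm_le (le_trans (TM x))// -[leRHS]mulr1 ler_wpM2l//.
by rewrite rnorm_le.
Qed.

Lemma bop_of_bound (f : U -> V) (M : R) : linear f ->
  (forall x, rnorm (f x) <= M * rnorm x) -> f \in @bounded_linear R U V.
Proof.
move=> fl fM; apply/asboolP; split=> //; exists M%:C => x.
by rewrite !rnormE -rmorphM lecR.
Qed.

Lemma bop_cvg (T : bop U V) (X : Type) (F : set_system X) {FF : Filter F}
  (u : X -> U) l : u @ F --> l -> (T \o u) @ F --> T l.
Proof.
move=> /cvg_rnormP ul; apply/cvg_rnormP => e e0.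
have T1 : 0 < rnorm T + 1 by rewrite ltr_wpDl ?rnorm_ge0.
have := ul (e / (rnorm T + 1)); rewrite divr_gt0// => /(_ isT).
apply: filterS => x /=; rewrite ltr_pdivlMr// => xl.
rewrite -linearB (le_lt_trans (bopK _ _))//.
apply: le_lt_trans xl; rewrite mulrC ler_wpM2l ?rnorm_ge0//.
by rewrite lerDl.
Qed.

Lemma bop_continuous (T : bop U V) : continuous T.
Proof. by move=> x; apply: (@bop_cvg T U (nbhs x) _ id x). Qed.

End BopNorm.

Lemma rnorm_comp (R : realType) (U V W : normedModType R[i]) (S : bop V W)
  (T : bop U V) : rnorm (S \co T) <= rnorm S * rnorm T.
Proof.
apply: rnorm_bop_le => [|x]; first by rewrite mulr_ge0 ?rnorm_ge0.
by rewrite (le_trans (bopK S _))// -mulrA ler_wpM2l ?rnorm_ge0 ?bopK.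
Qed.

Section StrongLimits.
Variables (R : realType).

Lemma rlim_le (u : nat -> R) (l M : R) :
  u n @[n --> \oo] --> l -> (forall n, u n <= M) -> l <= M.
Proof.
move=> ul uM; apply: (closed_cvg (fun y => y <= M)) ul => //.
by apply: nearW.
Qed.

(** Linearity and a uniform bound pass to pointwise limits. Convergence in
    operator norm would be too much to ask: the powers of a contraction converge
    only pointwise. *)
Lemma strong_limit (V : normedModType R[i]) (W : completeNormedModType R[i])
    (T : nat -> bop V W) (M : R) :
  (forall n, rnorm (T n) <= M) ->
  (forall x, exists l : W, T n x @[n --> \oo] --> l) ->
  exists2 L : bop V W, rnorm L <= M & forall x, T n x @[n --> \oo] --> L x.
Proof.
move=> TM /choice[f fT].
have M0 : 0 <= M by apply: le_trans (TM 0%N); exact: rnorm_ge0.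
have fl : linear f.
  move=> a x y; apply: (@cvg_unique W (@norm_hausdorff _ W)
    (T n (a *: x + y) @[n --> \oo])); first exact: fT.
  rewrite (_ : (fun n => _) = (fun n => a *: T n x + T n y)); last first.
    by apply/funext => n; rewrite linearP.
  by apply: cvgD; [apply: cvgZr|]; exact: fT.
have fM x : rnorm (f x) <= M * rnorm x.
  apply: rlim_le (rnorm_cvg (fT x)) _ => n.
  by rewrite (le_trans (bopK _ _))// ler_wpM2r ?rnorm_ge0.
exists (Bop (bop_of_bound fl fM)) => //.
exact: rnorm_bop_le.
Qed.

Lemma strong_cvg_comp (V W : normedModType R[i]) (T : nat -> bop V W)
    (u : nat -> V) (M : R) (l : V) (m : W) :
  (forall n, rnorm (T n) <= M) ->
  u n @[n --> \oo] --> l -> T n l @[n --> \oo] --> m ->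
  T n (u n) @[n --> \oo] --> m.
Proof.
move=> TM /cvg_rnormP ul /cvg_rnormP Tl; apply/cvg_rnormP => e e0.
have M0 : 0 <= M by apply: le_trans (TM 0%N); exact: rnorm_ge0.
have M1 : 0 < M + 1 by rewrite ltr_wpDl.
have e2 : 0 < e / 2 by rewrite divr_gt0.
have := ul (e / 2 / (M + 1)); rewrite divr_gt0// => /(_ isT) h.
apply: filterS2 h (Tl _ e2) => n /=; rewrite ltr_pdivlMr// => h1 h2.
have := rnormD (T n (u n) - T n l) (T n l - m); rewrite addrA subrK.
move=> /le_lt_trans; apply; rewrite [ltRHS]splitr; apply: ltrD => //.
apply: le_lt_trans h1; rewrite -linearB (le_trans (bopK _ _))// mulrC.
by rewrite ler_wpM2l ?rnorm_ge0// (le_trans (TM n))// lerDl.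
Qed.

End StrongLimits.

(** * Real inner products, symmetric operators and inverses *)

Section RealInner.
Variables (R : realType) (H : hilbertType R).
Implicit Types (x y z : H) (a : R).

(** The real inner product: for complex linear operators it detects symmetry and
    equality, and it takes values in a totally ordered field. *)
Definition rip x y : R := @complex.Re R (inner x y).

Lemma ripC x y : rip x y = rip y x.
Proof. by rewrite /rip innerC Re_conj. Qed.

Lemma ripDl x y z : rip (x + y) z = rip x z + rip y z.
Proof. by rewrite /rip linearDl ReD. Qed.

Lemma ripDr x y z : rip z (x + y) = rip z x + rip z y.
Proof. by rewrite ripC ripDl ![rip _ z]ripC. Qed.

Lemma ripZl a x y : rip (a%:C *: x) y = a * rip x y.
Proof. by rewrite /rip linearZl_LR ReZ. Qed.

Lemma ripZr a x y : rip x (a%:C *: y) = a * rip x y.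
Proof. by rewrite ripC ripZl ripC. Qed.

Lemma ripNl x y : rip (- x) y = - rip x y.
Proof. by rewrite /rip linearNl ReN. Qed.

Lemma ripNr x y : rip x (- y) = - rip x y.
Proof. by rewrite ripC ripNl ripC. Qed.

Lemma ripBl x y z : rip (x - y) z = rip x z - rip y z.
Proof. by rewrite ripDl ripNl. Qed.

Lemma ripBr x y z : rip z (x - y) = rip z x - rip z y.
Proof. by rewrite ripDr ripNr. Qed.

Lemma rip0l x : rip 0 x = 0.
Proof. by rewrite /rip linear0l. Qed.

Lemma ripil x y : rip ('i *: x) y = - rip x ('i *: y).
Proof.
rewrite /rip linearZl_LR linearZr_LR /=.
by case: (inner x y) => u v /=; ring.
Qed.

Lemma ripii x y : rip ('i *: x) ('i *: y) = rip x y.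
Proof. by rewrite ripil scalerA -expr2 sqr_i scaleN1r ripNr opprK. Qed.

Lemma rip_norm x : rip x x = rnorm x ^+ 2.
Proof. by rewrite /rip inner_norm rnormE -rmorphXn. Qed.

Lemma rnorm_i x : rnorm ('i *: x) = rnorm x.
Proof. by apply/eqP; rewrite -(@eqrXn2 _ 2) ?rnorm_ge0// -!rip_norm ripii. Qed.

Lemma rip_ge0 x : 0 <= rip x x.
Proof. by rewrite rip_norm exprn_ge0// rnorm_ge0. Qed.

Lemma rip_le x y : rip x y <= rnorm x * rnorm y.
Proof.
rewrite (le_trans (ler_norm _))// -lecR rmorphM/= -!rnormE.
exact: le_trans (normc_ge_Re _) (ler_inner _ _).
Qed.

Lemma rip_abs x y : `|rip x y| <= rnorm x * rnorm y.
Proof.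
by rewrite ler_norml rip_le lerNl -ripNl -[rnorm x]rnormN rip_le.
Qed.

Lemma rip_eq x y : (forall z, rip x z = rip y z) -> x = y.
Proof.
move=> xy; apply/eqP; rewrite -subr_eq0 -rnorm_eq0 -sqrf_eq0 -rip_norm.
by rewrite ripBl xy subrr.
Qed.

Lemma rip_cvg (T : Type) (F : set_system T) {FF : Filter F} (f : T -> H) x y :
  f @ F --> x -> rip (f t) y @[t --> F] --> rip x y.
Proof.
move=> /cvg_rnormP fx; apply/cvgrPdist_lt => e e0.
have y1 : 0 < rnorm y + 1 by rewrite ltr_wpDl ?rnorm_ge0.
have := fx (e / (rnorm y + 1)); rewrite divr_gt0// => /(_ isT).
apply: filterS => t /=; rewrite ltr_pdivlMr//; apply: le_lt_trans.
rewrite -ripBl (le_trans (rip_abs _ _))// rdistC ler_wpM2l ?rnorm_ge0//.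
by rewrite lerDl.
Qed.

End RealInner.

Lemma rnorm_sqr_le (R : realType) (H K : hilbertType R) (a : R) (x : H)
    (y : K) :
  0 <= a -> (rnorm x <= a * rnorm y) = (rip x x <= a ^+ 2 * rip y y).
Proof.
move=> a0; rewrite !rip_norm -exprMn ler_pXn2r// nnegrE ?mulr_ge0 ?rnorm_ge0//.
Qed.

Section RealAdjoint.
Variables (R : realType) (H K : hilbertType R).
Implicit Types T : bop H K.

Lemma rip_adjoint T x y : rip (T x) y = rip x (adjoint T y).
Proof. by rewrite /rip adjointP. Qed.

Lemma rip_adjointV T x y : rip (adjoint T x) y = rip x (T y).
Proof. by rewrite ripC -rip_adjoint ripC. Qed.

Lemma rnorm_adjoint_le T x : rnorm (adjoint T x) <= rnorm T * rnorm x.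
Proof.
have [->|x0] := eqVneq (adjoint T x) 0.
  by rewrite rnorm0 mulr_ge0 ?rnorm_ge0.
have n0 : 0 < rnorm (adjoint T x) by rewrite lt_def rnorm_eq0 x0 rnorm_ge0.
rewrite -(ler_pM2r n0) -expr2 -rip_norm -rip_adjoint (le_trans (rip_le _ _))//.
by rewrite mulrAC ler_wpM2r ?rnorm_ge0// bopK.
Qed.

End RealAdjoint.

Section Symmetric.
Variables (R : realType) (H : hilbertType R).
Implicit Types S T : bop H H.

Definition symmetric_bop T := forall x y, rip (T x) y = rip x (T y).

Definition nonneg_bop T := forall x, 0 <= rip (T x) x.

Definition contraction_bop T := forall x, rnorm (T x) <= rnorm x.

Lemma contraction_rip T :
  contraction_bop T <-> forall x, rip (T x) (T x) <= rip x x.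
Proof.
split=> Tc x; have := rnorm_sqr_le (T x) x ler01.
  by rewrite !mul1r expr1n mul1r Tc.
by rewrite expr1n !mul1r => ->.
Qed.

Lemma contraction_rnorm T : contraction_bop T <-> rnorm T <= 1.
Proof.
split=> [Tc|T1 x]; first by apply: rnorm_bop_le => // x; rewrite mul1r.
by rewrite (le_trans (bopK _ _))// -[leRHS]mul1r ler_wpM2r ?rnorm_ge0.
Qed.

End Symmetric.

Section Inverse.
Variables (R : realType) (H : hilbertType R).
Implicit Types S T G : bop H H.

Lemma bop_compA (U V W X : normedModType R[i]) (S : bop W X) (T : bop V W)
  (G : bop U V) : S \co T \co G = S \co (T \co G).
Proof. exact: bop_ext. Qed.

Lemma invertible_of_left_right T S S' :
  S \co T = bop_id H -> T \co S' = bop_id H -> invertible_bop T.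
Proof.
move=> ST TS; exists S; split=> //.
suff -> : S = S' by [].
apply: bop_ext => x; rewrite -[in RHS](bop1 (S' x)) -ST.
by rewrite bopC -[T (S' x)]bopC TS.
Qed.

Lemma invertible_id : invertible_bop (bop_id H).
Proof. by exists (bop_id H); split; exact: bop_ext. Qed.

Lemma invertible_comp S T :
  invertible_bop S -> invertible_bop T -> invertible_bop (S \co T).
Proof.
move=> [S' [S'S SS']] [T' [T'T TT']]; exists (T' \co S'); split.
  apply: bop_ext => x; rewrite !bopC -[S' (S _)]bopC S'S bop1.
  by rewrite -[T' (T _)]bopC T'T.
apply: bop_ext => x; rewrite !bopC -[T (T' _)]bopC TT' bop1.
by rewrite -[S (S' _)]bopC SS'.
Qed.

(** Total, because holomorphic mappings are represented by functions on the
    whole space; the value [0] is arbitrary. *)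
Definition bop_inv T : bop H H :=
  if pselect (invertible_bop T) is left TV then projT1 (cid TV) else 0.

Lemma bop_invP T : invertible_bop T ->
  bop_inv T \co T = bop_id H /\ T \co bop_inv T = bop_id H.
Proof.
by move=> TV; rewrite /bop_inv; case: pselect => // h; case: cid.
Qed.

Lemma bop_invK T x : invertible_bop T -> bop_inv T (T x) = x.
Proof. by move=> /bop_invP[h _]; rewrite -bopC h. Qed.

Lemma bop_invVK T x : invertible_bop T -> T (bop_inv T x) = x.
Proof. by move=> /bop_invP[_ h]; rewrite -bopC h. Qed.

Lemma invertible_inv T : invertible_bop T -> invertible_bop (bop_inv T).
Proof. by move=> /bop_invP[? ?]; exists T. Qed.

Lemma bop_invE T S : S \co T = bop_id H -> T \co S = bop_id H ->
  bop_inv T = S.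
Proof.
move=> ST TS; apply: bop_ext => x.
have TV : invertible_bop T by exists S.
by rewrite -[x in LHS]bop1 -TS bopC bop_invK.
Qed.

Lemma bop_inv_inv T : invertible_bop T -> bop_inv (bop_inv T) = T.
Proof. by move=> /bop_invP[? ?]; apply: bop_invE. Qed.

Lemma invertible_inj T x y : invertible_bop T -> T x = T y -> x = y.
Proof. by move=> TV Txy; rewrite -(bop_invK x TV) Txy bop_invK. Qed.

Lemma symmetric_inv T : invertible_bop T -> symmetric_bop T ->
  symmetric_bop (bop_inv T).
Proof.
move=> TV Ts x y; rewrite -{2}(bop_invVK x TV) -{1}(bop_invVK y TV).
by rewrite Ts.
Qed.

(** Richardson iteration: the error operator [1 - t G] of the step
    [S |-> S - t (G S - 1)] is a strict contraction for small [t > 0], because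
    accretivity makes [|x - t G x| ^ 2] smaller than [|x| ^ 2] to first order
    in [t]. *)
Theorem accretive_invertible G (c : R) : 0 < c ->
  (forall x, c * rip x x <= rip (G x) x) -> invertible_bop G.
Proof.
move=> c0 Gc.
pose g := rnorm G + c; have g0 : 0 < g by rewrite ltr_wpDl ?rnorm_ge0.
(* The square of the norm of [1 - t G] is at most [1 - c ^ 2 / g ^ 2] for
   [t = c / g ^ 2], and [q] is a bound for the square root of that. *)
pose t := c / g ^+ 2; pose q : R := 1 - t * c / 2.
have t0 : 0 < t by rewrite divr_gt0 ?exprn_gt0.
have tg : t * g ^+ 2 = c by rewrite divfK// gt_eqF ?exprn_gt0.
have cg : c <= g by rewrite lerDr rnorm_ge0.
have tc1 : t * c <= 1.
  rewrite mulrAC ler_pdivrMr ?exprn_gt0// mul1r -expr2.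
  by rewrite ler_pXn2r// nnegrE ltW.
have tc0 : 0 < t * c by rewrite mulr_gt0.
have q0 : 0 <= q by rewrite /q; lra.
have q1 : q < 1 by rewrite /q; lra.
have Gg x : rip (G x) (G x) <= g ^+ 2 * rip x x.
  rewrite -rnorm_sqr_le ?(ltW g0)// (le_trans (bopK _ _))//.
  by rewrite ler_wpM2r ?rnorm_ge0// lerDl ltW.
pose E : bop H H := bop_id H - t%:C *: G.
have Eq : rnorm E <= q.
  apply: rnorm_bop_le => // x; rewrite rnorm_sqr_le//.
  rewrite bopB bopZ bop1 ripBl !ripBr ripZl !ripZr ripZl [rip x (G x)]ripC.
  have h1 : t ^+ 2 * rip (G x) (G x) <= t * c * rip x x.
    rewrite -[in leRHS]tg mulrA -expr2 -mulrA.
    by rewrite ler_pM2l ?exprn_gt0.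
  have h2 : t * (c * rip x x) <= t * rip (G x) x by rewrite ler_pM2l.
  have h3 : 0 <= (t * c / 2) ^+ 2 * rip x x.
    by rewrite mulr_ge0 ?rip_ge0// sqr_ge0.
  rewrite /q; move: h1 h2 h3; set u := rip x x; set v := rip (G x) x.
  set w := rip (G x) (G x) => h1 h2 h3.
  have -> : (1 - t * c / 2) ^+ 2 * u =
    u - t * c * u + (t * c / 2) ^+ 2 * u by field.
  have -> : u - t * v - (t * v - t * (t * w)) = u - t * v *+ 2 + t ^+ 2 * w.
    by ring.
  lra.
have EE x : E x = x - t%:C *: G x by [].
clearbody E.
pose S := fix S n : bop H H :=
  if n is m.+1 then E \co S m + t%:C *: bop_id H else 0.
pose y := fix y n : R := if n is m.+1 then q * y m + t else 0.
have SE n : S n.+1 = E \co S n + t%:C *: bop_id H by [].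
have yE n : y n.+1 = q * y n + t by [].
have ES n x : S n.+1 x = S n x - t%:C *: (G (S n x) - x).
  by rewrite SE bopD bopC EE bopZ bop1 scalerBr opprB addrCA addrC.
have yM n : y n <= t / (1 - q).
  elim: n => [|n IHn]; first by rewrite divr_ge0 ?(ltW t0)// subr_ge0 ltW.
  rewrite yE; have -> : t / (1 - q) = q * (t / (1 - q)) + t.
    by field; rewrite gt_eqF// subr_gt0.
  by rewrite lerD2r ler_wpM2l.
have step n : rnorm (S n.+1 - S n) <= y n.+1 - y n.
  elim: n => [|n IHn].
    rewrite yE SE [y 0%N]/= [S 0%N]/= mulr0 add0r !subr0.
    apply: rnorm_bop_le => [|x].
      exact: ltW.
    by rewrite bopD bopC bop0 linear0 add0r bopZ bop1 rnormZ gtr0_norm.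
  have -> : S n.+2 - S n.+1 = E \co (S n.+1 - S n).
    have SEx m x : S m.+1 x = E (S m x) + t%:C *: x by rewrite SE bopD.
    apply: bop_ext => x; rewrite bopC !bopB linearB SEx {2}SEx.
    by rewrite opprD addrACA subrr addr0.
  rewrite (le_trans (rnorm_comp _ _))//.
  have -> : y n.+2 - y n.+1 = q * (y n.+1 - y n).
    by rewrite !yE; ring.
  by rewrite ler_pM ?rnorm_ge0.
have yS n : rnorm (S n) <= y n.
  elim: n => [|n IHn]; first by rewrite rnorm0.
  have := rnormD (S n.+1 - S n) (S n); rewrite subrK => /le_trans; apply.
  by have := step n; move: IHn; lra.
have Scvg x : exists l : H, S n x @[n --> \oo] --> l.
  apply: (@cvg_of_steps _ _ _ (fun n => y n * rnorm x)
    (t / (1 - q) * rnorm x)) => n; first by rewrite ler_wpM2r ?rnorm_ge0.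
  by rewrite -bopB (le_trans (bopK _ _))// -mulrBl ler_wpM2r ?rnorm_ge0.
have [L _ SL] := strong_limit (fun n => le_trans (yS n) (yM n)) Scvg.
have GL : G \co L = bop_id H.
  apply: bop_ext => x.
  have h1 : S n.+1 x @[n --> \oo] --> L x.
    by have := SL x; rewrite -cvg_shiftS.
  have h2 : S n x - t%:C *: (G (S n x) - x) @[n --> \oo] -->
      L x - t%:C *: (G (L x) - x).
    apply: cvgB; [exact: SL|apply: cvgZr; apply: cvgB; last exact: cvg_cst].
    exact: bop_cvg (SL x).
  have h3 : L x = L x - t%:C *: (G (L x) - x).
    apply: (@cvg_unique H (@norm_hausdorff _ H) (S n.+1 x @[n --> \oo])) => //.
    suff -> : (fun n => S n.+1 x) =
      (fun n => S n x - t%:C *: (G (S n x) - x)) by [].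
    by apply/funext => n; exact: ES.
  move/eqP: h3; rewrite -subr_eq0 opprB addrCA subrr addr0 scaler_eq0.
  by rewrite gt_eqF ?ltcR//= subr_eq0 => /eqP.
have Gi x : G x = 0 -> x = 0.
  move=> Gx0; have := Gc x; rewrite Gx0 rip0l pmulr_rle0// => x0.
  by apply/eqP; rewrite -rnorm_eq0 -sqrf_eq0 -rip_norm eq_le x0 rip_ge0.
exists L; split=> //; apply: bop_ext => x.
apply/eqP; rewrite -subr_eq0; apply/eqP; apply: Gi.
rewrite linearB; apply/eqP; rewrite subr_eq0; apply/eqP.
by rewrite [LHS]/= -[LHS]bopC GL.
Qed.

End Inverse.

(** * Square roots, projections and signs of symmetric operators *)

Section SquareRoot.
Variables (R : realType) (H : hilbertType R).
Implicit Types A B C D F P Q S T : bop H H.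

Definition commute_bop S T := S \co T = T \co S.

Lemma commute_bopE S T : commute_bop S T <-> forall x, S (T x) = T (S x).
Proof.
by split=> [ST x|ST]; [rewrite -!bopC ST|apply: bop_ext => x; rewrite !bopC].
Qed.

Lemma symmetric_cvg (T : nat -> bop H H) S :
  (forall n, symmetric_bop (T n)) -> (forall x, T n x @[n --> \oo] --> S x) ->
  symmetric_bop S.
Proof.
move=> Ts TS x y.
apply: (@cvg_unique R (@Rhausdorff R) (rip (T n x) y @[n --> \oo])).
  exact: rip_cvg.
rewrite (_ : (fun n => rip (T n x) y) = (fun n => rip (T n y) x)).
  by rewrite ripC; exact: rip_cvg.
by apply/funext => n; rewrite Ts ripC.
Qed.

Lemma commute_cvg (T : nat -> bop H H) S B :
  (forall n, commute_bop B (T n)) -> (forall x, T n x @[n --> \oo] --> S x) ->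
  commute_bop B S.
Proof.
move=> BT TS; apply/commute_bopE => x.
apply: (@cvg_unique H (@norm_hausdorff _ H) (T n (B x) @[n --> \oo]));
  last exact: TS.
rewrite (_ : (fun n => T n (B x)) = (fun n => B (T n x))).
  exact: bop_cvg.
by apply/funext => n; have /commute_bopE -> := BT n.
Qed.

Lemma Re_norm_half : @complex.Re R `|2^-1%:C| = 2^-1.
Proof. by rewrite Re_norm_real ger0_norm// invr_ge0. Qed.

(** The root is [1 - Y], where [Y] solves [Y = (A + Y ^ 2) / 2]. The iterates
    of that equation from [0] have increments bounded by those of the scalar
    iteration [y = (1 + y ^ 2) / 2], which increases and stays below [1]; so
    they converge although the equation is not a strict contraction when
    [|A| = 1]. *)
Theorem square_root_exists A : symmetric_bop A -> contraction_bop A ->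
  exists S, [/\ symmetric_bop S, nonneg_bop S, S \co S = bop_id H - A
    & forall T, commute_bop T A -> commute_bop T S].
Proof.
move=> As /contraction_rnorm Ac.
pose Y := fix Y n : bop H H :=
  if n is m.+1 then 2^-1%:C *: (A + Y m \co Y m) else 0.
pose y := fix y n : R := if n is m.+1 then 2^-1 * (1 + y m ^+ 2) else 0.
have YE n : Y n.+1 = 2^-1%:C *: (A + Y n \co Y n) by [].
have yE n : y n.+1 = 2^-1 * (1 + y n ^+ 2) by [].
have y01 n : 0 <= y n <= 1.
  elim: n => [|n /andP[y0 y1]]; first by rewrite lexx ler01.
  have : y n ^+ 2 <= 1 by rewrite expr_le1.
  have := sqr_ge0 (y n).
  by rewrite yE => h1 h2; apply/andP; split; lra.
have Yy n : rnorm (Y n) <= y n.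
  elim: n => [|n IHn]; first by rewrite rnorm0.
  rewrite YE yE rnorm_normZ Re_norm_half ler_pM2l ?invr_gt0//.
  rewrite (le_trans (rnormD _ _))// lerD// (le_trans (rnorm_comp _ _))//.
  by rewrite expr2 ler_pM ?rnorm_ge0.
have step n : rnorm (Y n.+1 - Y n) <= y n.+1 - y n.
  elim: n => [|n IHn].
    rewrite YE yE [Y 0%N]/= [y 0%N]/= !subr0 rnorm_normZ Re_norm_half.
    rewrite ler_pM2l ?invr_gt0// expr0n addr0 (_ : A + _ = A)//.
    by apply: bop_ext => x; rewrite bopD bopC bop0 addr0.
  have -> : Y n.+2 - Y n.+1 =
      2^-1%:C *: ((Y n.+1 - Y n) \co Y n.+1 + Y n \co (Y n.+1 - Y n)).
    rewrite [in Y n.+2]YE [in X in _ - X]YE -scalerBr; congr (_ *: _).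
    apply: bop_ext => x; rewrite bopB !bopD !bopC !bopB linearB.
    by rewrite opprD addrACA subrr add0r addrA subrK.
  have -> : y n.+2 - y n.+1 =
      2^-1 * ((y n.+1 - y n) * y n.+1 + y n * (y n.+1 - y n)).
    by rewrite [y n.+2]yE [in X in _ - X]yE; ring.
  rewrite rnorm_normZ Re_norm_half ler_pM2l ?invr_gt0//.
  rewrite (le_trans (rnormD _ _))// lerD// (le_trans (rnorm_comp _ _))//;
  by rewrite ler_pM ?rnorm_ge0.
have Y1 n : rnorm (Y n) <= 1 by have /andP[_] := y01 n; exact: le_trans.
have Ycvg x : exists l : H, Y n x @[n --> \oo] --> l.
  apply: (@cvg_of_steps _ _ _ (fun n => y n * rnorm x) (rnorm x)) => n.
    by rewrite -[leRHS]mul1r ler_wpM2r ?rnorm_ge0//; case/andP: (y01 n).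
  by rewrite -bopB (le_trans (bopK _ _))// -mulrBl ler_wpM2r ?rnorm_ge0.
have [L L1 YL] := strong_limit Y1 Ycvg.
have LE x : L x = 2^-1%:C *: (A x + L (L x)).
  apply: (@cvg_unique H (@norm_hausdorff _ H) (Y n.+1 x @[n --> \oo])).
    by have := YL x; rewrite -cvg_shiftS.
  rewrite (_ : (fun n => Y n.+1 x) =
    (fun n => 2^-1%:C *: (A x + Y n (Y n x))))//.
  apply: cvgZr; apply: cvgD; first exact: cvg_cst.
  exact: strong_cvg_comp Y1 (YL x) (YL (L x)).
exists (bop_id H - L); split.
- have Ls : symmetric_bop L.
    apply: symmetric_cvg YL; elim=> [|n IHn] u v.
      by rewrite !bop0 [RHS]ripC !rip0l.
    by rewrite YE !bopZ ripZl ripZr !bopD !bopC ripDl ripDr As !IHn.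
  by move=> u v; rewrite !bopB !bop1 ripBl ripBr Ls.
- move=> x; rewrite bopB bop1 ripBl subr_ge0 (le_trans (rip_le _ _))//.
  rewrite rip_norm expr2 ler_wpM2r ?rnorm_ge0//.
  by rewrite (le_trans (bopK _ _))// -[leRHS]mul1r ler_wpM2r ?rnorm_ge0.
- apply: bop_ext => x; rewrite bopC !bopB !bop1 linearB opprB /=.
  have : L x + L x = A x + L (L x).
    rewrite {1 2}LE -scalerDl -rmorphD/= (_ : 2^-1 + 2^-1 = 1) ?scale1r//.
    by field.
  by rewrite addrACA -opprD => ->; rewrite opprD addrACA subrr addr0.
- move=> T TA; have /commute_bopE TL : commute_bop T L.
    apply: commute_cvg YL.
    elim=> [|n /commute_bopE IHn]; apply/commute_bopE => x.
      by rewrite !bop0 linear0.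
    have /commute_bopE {}TA := TA.
    by rewrite YE !bopZ !bopD !bopC linearZ linearD /= TA !IHn.
  by apply/commute_bopE => x; rewrite !bopB linearB/= TL.
Qed.

Definition bop_pow Q n : bop H H := iter n (bop_comp Q) (bop_id H).

Lemma bop_powS Q n x : bop_pow Q n.+1 x = Q (bop_pow Q n x).
Proof. by []. Qed.

Lemma bop_powD Q m n x : bop_pow Q (m + n) x = bop_pow Q m (bop_pow Q n x).
Proof. by elim: m => // m IHm; rewrite addSn !bop_powS IHm. Qed.

(** The powers [Q ^ (2 n)] of a symmetric contraction converge strongly, to the
    orthogonal projection on the fixed points of [Q ^ 2]: with
    [a n = |Q ^ n x| ^ 2], which is nonincreasing, symmetry gives
    [|Q ^ (2 m) x - Q ^ (2 n) x| ^ 2 = a (2 m) + a (2 n) - 2 a (m + n)]. *)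
Theorem fixed_projection Q : symmetric_bop Q -> contraction_bop Q ->
  exists P, [/\ symmetric_bop P, P \co P = P, Q \co Q \co P = P,
    forall T, commute_bop T Q -> commute_bop T P
    & forall D, D \co Q = D -> D \co P = D].
Proof.
move=> Qs Qc.
have pw_sym n x y : rip (bop_pow Q n x) y = rip x (bop_pow Q n y).
  elim: n x y => // n IHn x y.
  by rewrite bop_powS Qs IHn -[Q y]/(bop_pow Q 1 y) -bop_powD addn1.
have pw_le n x : rnorm (bop_pow Q n x) <= rnorm x.
  by elim: n => // n IHn; rewrite bop_powS (le_trans (Qc _)).
have pw1 n : rnorm (bop_pow Q n) <= 1 by apply/contraction_rnorm => x.
pose a x n := rip (bop_pow Q n x) (bop_pow Q n x).
have aP x m n : rip (bop_pow Q m.*2 x) (bop_pow Q n.*2 x) = a x (m + n)%N.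
  rewrite -!addnn bop_powD pw_sym -bop_powD addnA addnC bop_powD -pw_sym.
  by rewrite -bop_powD /a addnC.
have a_le x m n : (m <= n)%N -> a x n <= a x m.
  move=> /subnK <-; rewrite /a bop_powD.
  by rewrite !rip_norm ler_pXn2r ?nnegrE ?rnorm_ge0.
have Pcvg x : exists l : H, bop_pow Q n.*2 x @[n --> \oo] --> l.
  apply: (@cvg_of_increments _ _ _ (fun n => - a x n.*2) 0 1) => [n|n m nm].
    by rewrite oppr_le0 rip_ge0.
  rewrite -rip_norm ripBl !ripBr.
  rewrite [rip (bop_pow Q n.*2 x) (bop_pow Q m.*2 x)]ripC.
  rewrite !aP !addnn.
  have : a x m.*2 <= a x (m + n)%N by rewrite a_le// -addnn leq_add2l.
  lra.
have [P P1 PQ] := strong_limit (fun n => pw1 n.*2) Pcvg.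
have QQP x : Q (Q (P x)) = P x.
  apply: (@cvg_unique H (@norm_hausdorff _ H)
    (bop_pow Q n.+1.*2 x @[n --> \oo])).
    rewrite (_ : (fun n => _) = (fun n => Q (Q (bop_pow Q n.*2 x)))).
      by apply: bop_cvg; apply: bop_cvg; exact: PQ.
    by apply/funext => n; rewrite doubleS !bop_powS.
  by have := PQ x; rewrite -cvg_shiftS.
have pwP n x : bop_pow Q n.*2 (P x) = P x.
  by elim: n => // n IHn; rewrite doubleS !bop_powS IHn QQP.
exists P; split.
- by apply: symmetric_cvg PQ => n x y; exact: pw_sym.
- apply: bop_ext => x; rewrite bopC.
  apply: (@cvg_unique H (@norm_hausdorff _ H)
    (bop_pow Q n.*2 (P x) @[n --> \oo])); first exact: PQ.
  rewrite (_ : (fun n => _) = (fun n => P x)); first exact: cvg_cst.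
  by apply/funext => n; rewrite pwP.
- by apply: bop_ext => x; rewrite !bopC QQP.
- move=> T /commute_bopE TQ; apply: commute_cvg PQ => n; apply/commute_bopE.
  by elim: n.*2 => // m IHm x; rewrite !bop_powS TQ IHm.
- move=> D DQ; apply: bop_ext => x; rewrite bopC.
  have DQx y : D (Q y) = D y by rewrite -[LHS]bopC DQ.
  apply: (@cvg_unique H (@norm_hausdorff _ H)
    (D (bop_pow Q n.*2 x) @[n --> \oo])); first by apply: bop_cvg; exact: PQ.
  rewrite (_ : (fun n => _) = (fun n => D x)); first exact: cvg_cst.
  by apply/funext => n; elim: n.*2 => // m IHm; rewrite bop_powS DQx.
Qed.

(** With [C = |B| - B] and [D = |B| + B], where [|B|] is the square root of
    [B ^ 2], [D C = 0]. So the projection [P] on the kernel of [C] satisfies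
    [B P = |B| P] and [B (1 - P) = - |B| (1 - P)], and [F = 2 P - 1] works,
    since [F B = |B|]. *)
Theorem sign_exists B : symmetric_bop B -> contraction_bop B ->
  exists F, [/\ symmetric_bop F, F \co F = bop_id H, nonneg_bop (F \co B)
    & forall T, commute_bop T B -> commute_bop T F].
Proof.
move=> Bs Bc.
have Bc2 : forall x, rip (B x) (B x) <= rip x x by apply/contraction_rip.
have [||M [Ms M0 MM Mcomm]] := @square_root_exists (bop_id H - B \co B).
- by move=> x y; rewrite !bopB !bop1 !bopC ripBl ripBr Bs Bs.
- apply/contraction_rip => x; rewrite bopB bop1 bopC ripBl !ripBr.
  rewrite [rip x (B _)]ripC [rip (B (B x)) x]Bs.
  by have := Bc2 (B x); have := rip_ge0 (B x); lra.
have {}MM x : M (M x) = B (B x).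
  by rewrite -[LHS]bopC MM !bopB bop1 opprB addrC subrK bopC.
have MB : commute_bop B M.
  apply: Mcomm; apply/commute_bopE => x.
  by rewrite !bopB !bopC linearB.
have /commute_bopE BM := MB.
have MBn x : rip (M x) (M x) = rip (B x) (B x) by rewrite Ms MM -Bs.
pose C := M - B; pose D := M + B.
have CE x : C x = M x - B x by [].
have DE x : D x = M x + B x by [].
clearbody C D.
have Cs : symmetric_bop C.
  by move=> x y; rewrite !CE ripBl ripBr Ms Bs.
have DC x : D (C x) = 0.
  by rewrite DE CE !linearB/= MM BM addrA subrK subrr.
(* [|C| <= 2], so that [0 <= 1 - C ^ 2 / 4 <= 1]. *)
have C4 x : rip (C x) (C x) <= 4 * rip x x.
  have : 0 <= rip (D x) (D x) by exact: rip_ge0.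
  rewrite CE DE !ripBl !ripDl !ripBr !ripDr MBn.
  by have := Bc2 x; lra.
pose Q := bop_id H - 4^-1%:C *: (C \co C).
have QE x : Q x = x - 4^-1%:C *: C (C x) by [].
clearbody Q.
have Q_norm x : rip (Q x) (Q x) <= rip x x - 4^-1 * rip (C x) (C x).
  rewrite QE ripBl !ripBr !ripZl !ripZr [rip x (C _)]ripC [rip (C (C x)) x]Cs.
  by have := C4 (C x); lra.
have Qc : contraction_bop Q.
  apply/contraction_rip => x; apply: le_trans (Q_norm x) _.
  by have := rip_ge0 (C x); lra.
have Qs : symmetric_bop Q.
  by move=> x y; rewrite !QE ripBl ripBr ripZl ripZr !Cs.
have [P [Ps PP QQP Pcomm PD]] := fixed_projection Qs Qc.
(* [Q] preserves the norm on the range of [P], but shortens every vector outside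
   the kernel of [C]. *)
have CP x : C (P x) = 0.
  have QQPx : Q (Q (P x)) = P x by rewrite -[in RHS]QQP.
  have := Q_norm (P x).
  have : rip (Q (Q (P x))) (Q (Q (P x))) <= rip (Q (P x)) (Q (P x)).
    by have /contraction_rip := Qc; exact.
  rewrite QQPx => h1 h2; apply/eqP; rewrite -rnorm_eq0 -sqrf_eq0 -rip_norm.
  by rewrite eq_le rip_ge0 andbT; lra.
(* [D Q = D] because [D C = 0], and this survives in the limit of the powers
   of [Q]. *)
have DP x : D (P x) = D x.
  rewrite -bopC PD//; apply: bop_ext => y.
  by rewrite bopC QE linearB linearZ/= DC scaler0 subr0.
have PPx x : P (P x) = P x by rewrite -bopC PP.
have QB T : commute_bop T B -> commute_bop T Q.
  move=> TB; have /commute_bopE TM : commute_bop T M.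
    apply: Mcomm; apply/commute_bopE => x; have /commute_bopE {}TB := TB.
    by rewrite !bopB !bopC linearB/= !TB.
  have TC x : T (C x) = C (T x).
    by have /commute_bopE {}TB := TB; rewrite !CE linearB/= TM TB.
  by apply/commute_bopE => x; rewrite !QE linearB linearZ/= !TC.
have PB x : P (B x) = B (P x).
  by apply/esym; move: x; apply/commute_bopE/Pcomm/QB.
pose F := P + P - bop_id H.
have FE x : F x = P x + P x - x by [].
clearbody F.
exists F; split.
- by move=> x y; rewrite !FE ripBl ripBr ripDl ripDr Ps.
- have PF x : P (F x) = P x by rewrite FE linearB linearD/= PPx addrK.
  by apply: bop_ext => x; rewrite bopC FE PF FE opprB addrC subrK.
- move=> x; rewrite bopC FE PB.
  have h1 : B (P x) = M (P x).
    by have := CP x; rewrite CE => /eqP; rewrite subr_eq0 => /eqP.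
  have h2 : B x = M (P x) + B (P x) - M x.
    by rewrite -DE DP DE addrAC subrr add0r.
  by rewrite (_ : _ - B x = M x)// h2 h1 opprB addrC subrK.
- move=> T TB; have /commute_bopE TP := Pcomm _ (QB _ TB).
  by apply/commute_bopE => x; rewrite !FE linearB linearD/= TP.
Qed.

End SquareRoot.

(** * The invertible operators form a connected open set *)

Section Segments.
Variables (R : realType) (V : normedModType R[i]).

Lemma component_segment (A : set V) (x y : V) :
  (forall t : R, 0 <= t <= 1 -> A ((1 - t)%:C *: x + t%:C *: y)) ->
  connected_component A x y.
Proof.
move=> Axy; pose f (t : R) := (1 - t)%:C *: x + t%:C *: y.
exists (f @` `[0, 1]%classic).
  split.
  - exists 0; first by rewrite /= in_itv/= lexx ler01.
    by rewrite /f subr0 scale1r scale0r addr0.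
  - by move=> _ [t t01 <-]; apply: Axy; move: t01; rewrite /= in_itv.
  - apply: connected_continuous_connected; first exact: segment_connected.
    apply: continuous_subspaceT => t; apply/cvg_rnormP => e e0.
    have k0 : 0 < rnorm (y - x) + 1 by rewrite ltr_wpDl ?rnorm_ge0.
    apply/nbhs_ballP; exists (e / (rnorm (y - x) + 1)).
      by rewrite /= divr_gt0.
    move=> s; rewrite /ball/= ltr_pdivlMr// => st.
    have -> : f s - f t = (s - t)%:C *: (y - x).
      rewrite /f opprD addrACA -!scalerBl -!rmorphB/=.
      rewrite (_ : 1 - s - (1 - t) = - (s - t)); last by ring.
      by rewrite rmorphN scaleNr addrC -scalerBr.
    rewrite rnormZ; apply: le_lt_trans st; rewrite distrC ler_wpM2l//.
    by rewrite lerDl.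
exists 1; first by rewrite /= in_itv/= lexx ler01.
by rewrite /f subrr scale0r scale1r add0r.
Qed.

End Segments.

Lemma component_image (V W : topologicalType) (A : set V) (B : set W)
    (f : V -> W) x y : continuous f -> (forall z, A z -> B (f z)) ->
  connected_component A x y -> connected_component B (f x) (f y).
Proof.
move=> fc AB [C [Cx CA Cc] Cy]; exists (f @` C); last by exists y.
split; first by exists x.
  by move=> _ [z Cz <-]; apply/AB/CA.
by apply: connected_continuous_connected Cc _; exact: continuous_subspaceT.
Qed.

Lemma connected_of_component (V : topologicalType) (A : set V) x :
  (forall y, A y -> connected_component A x y) -> connected A.
Proof.
move=> Ax; suff -> : A = connected_component A x by exact: component_connected.
by apply/seteqP; split=> [y /Ax//|]; exact: connected_component_sub.
Qed.

Section Multiplications.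
Variable R : realType.

Lemma bop_lmul_subproof (U V W : normedModType R[i]) (S : bop V W) :
  (fun T : bop U V => S \co T) \in @bounded_linear R (bop U V) (bop U W).
Proof.
apply: (bop_of_bound (M := rnorm S)) => [a T T'|T]; last exact: rnorm_comp.
by apply: bop_ext => x; rewrite bopD bopZ !bopC bopD bopZ linearP.
Qed.

Definition bop_lmul (U V W : normedModType R[i]) (S : bop V W) :
  bop (bop U V) (bop U W) := Bop (bop_lmul_subproof U S).

Lemma bop_rmul_subproof (U V W : normedModType R[i]) (S : bop U V) :
  (fun T : bop V W => T \co S) \in @bounded_linear R (bop V W) (bop U W).
Proof.
apply: (bop_of_bound (M := rnorm S)) => [a T T'|T]; first exact: bop_ext.
by rewrite mulrC rnorm_comp.
Qed.

Definition bop_rmul (U V W : normedModType R[i]) (S : bop U V) :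
  bop (bop V W) (bop U W) := Bop (bop_rmul_subproof W S).

End Multiplications.

Section GeneralLinear.
Variables (R : realType) (H : hilbertType R).
Implicit Types E G S T U : bop H H.

Lemma invertible_near_id E : rnorm E < 1 -> invertible_bop (bop_id H + E).
Proof.
move=> E1; apply: (@accretive_invertible _ _ _ (1 - rnorm E)).
  by rewrite subr_gt0.
move=> x; rewrite bopD bop1 ripDl mulrBl mul1r lerD2l lerNl -ripNl.
rewrite (le_trans (rip_le _ _))// rnormN rip_norm expr2 mulrA.
by rewrite ler_wpM2r ?rnorm_ge0// bopK.
Qed.

Lemma invertible_adjoint T : invertible_bop T -> invertible_bop (adjoint T).
Proof.
move=> [S [ST TS]]; exists (adjoint S); split; apply: bop_ext => x;
  apply: rip_eq => y; rewrite bopC !rip_adjointV -bopC ?TS ?ST bop1 //.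
Qed.

Lemma invertible_perturb T E : invertible_bop T ->
  rnorm (bop_inv T) * rnorm E < 1 -> invertible_bop (T + E).
Proof.
move=> TV TE; have -> : T + E = T \co (bop_id H + bop_inv T \co E).
  by apply: bop_ext => x; rewrite bopC !bopD bopC linearD/= bop_invVK.
apply: invertible_comp => //; apply: invertible_near_id.
exact: le_lt_trans (rnorm_comp _ _) TE.
Qed.

Lemma invertible_open : open (general_linear H).
Proof.
rewrite openE => T TV; apply/nbhs_rnormP.
have k0 : 0 < rnorm (bop_inv T) + 1 by rewrite ltr_wpDl ?rnorm_ge0.
exists (rnorm (bop_inv T) + 1)^-1; first by rewrite invr_gt0.
move=> S; rewrite -[X in _ < X]mul1r ltr_pdivlMr// => ST.
rewrite -[S](subrK T) addrC; apply: invertible_perturb => //.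
by apply: le_lt_trans ST; rewrite mulrC ler_wpM2l ?rnorm_ge0// lerDl.
Qed.

(** Left multiplication by [S] moves a connected set that joins the identity to
    [T] to one that joins [S] to [S T]. *)
Lemma component_comp S T : invertible_bop S ->
  connected_component (general_linear H) (bop_id H) S ->
  connected_component (general_linear H) (bop_id H) T ->
  connected_component (general_linear H) (bop_id H) (S \co T).
Proof.
move=> SV S1 T1; apply: connected_component_trans S1 _.
have -> : connected_component (general_linear H) S =
  connected_component (general_linear H) (S \co bop_id H).
  by congr (connected_component _ _); exact: bop_ext.
apply: (component_image (f := bop_lmul H S) _ _ T1) => [|T' T'V].
  exact: bop_continuous.
exact: invertible_comp.
Qed.

(** Along the segment from [G] to the identity the real part stays positive,
    and strictly so except possibly at [G]. *)
Lemma component_nonneg G : invertible_bop G -> nonneg_bop G ->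
  connected_component (general_linear H) (bop_id H) G.
Proof.
move=> GV G0; apply: connected_component_sym; apply: component_segment => t.
case/andP=> t0 t1; have [->|tn0] := eqVneq t 0.
  by rewrite subr0 scale1r scale0r addr0.
apply: (@accretive_invertible _ _ _ t); first by rewrite lt_def tn0.
move=> x; rewrite bopD !bopZ bop1 ripDl !ripZl lerDr mulr_ge0//.
by rewrite subr_ge0.
Qed.

(** For unitary [U] with imaginary part [B], let [V = i F], where [F] is the
    sign of [B]. Then [U = V (V^-1 U)], the operator [V] has real part [0],
    and [V^-1 U] has real part [F B >= 0]. *)
Lemma component_unitary U : invertible_bop U ->
  (forall x y, rip (U x) (U y) = rip x y) ->
  connected_component (general_linear H) (bop_id H) U.
Proof.
move=> UV Uu; pose U' := bop_inv U.
have U'U x : U' (U x) = x by exact: bop_invK.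
have UU' x : U (U' x) = x by exact: bop_invVK.
have Uadj x y : rip (U x) y = rip x (U' y) by rewrite -[RHS]Uu UU'.
have U'adj x y : rip (U' x) y = rip x (U y) by rewrite -[LHS]Uu UU'.
have Un x : rnorm (U x) = rnorm x.
  by apply/eqP; rewrite -(@eqrXn2 _ 2) ?rnorm_ge0// -!rip_norm Uu.
have U'n x : rnorm (U' x) = rnorm x by rewrite -[in RHS](UU' x) Un.
pose B : bop H H := 2^-1%:C *: ('i *: (U' - U)).
have BE x : B x = 2^-1%:C *: ('i *: (U' x - U x)) by [].
clearbody B.
have Bs : symmetric_bop B.
  move=> x y; rewrite !BE ripZl ripZr ripil ripBl U'adj Uadj -ripBr -ripNr.
  by rewrite opprB !linearZ/= scalerDr scalerN.
have Bc : contraction_bop B.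
  move=> x; rewrite BE rnormZ rnorm_i ger0_norm ?invr_ge0//.
  have := rnormB (U' x) (U x); rewrite U'n Un; lra.
have [F [Fs FF FB Fcomm]] := sign_exists Bs Bc.
have FFx x : F (F x) = x by rewrite -bopC FF.
have UF : commute_bop U F.
  apply: Fcomm; apply/commute_bopE => x.
  have UZ a y : U (a *: y) = a *: U y by rewrite linearZ.
  by rewrite !BE !UZ linearB/= UU' U'U.
pose V : bop H H := 'i *: F; pose V' : bop H H := - ('i *: F).
have VE x : V x = 'i *: F x by [].
have V'E x : V' x = - ('i *: F x) by [].
clearbody V V'.
have FZ a x : F (a *: x) = a *: F x by rewrite linearZ.
have FN x : F (- x) = - F x by rewrite linearN.
have VV' : V \co V' = bop_id H.
  apply: bop_ext => x; rewrite bopC VE V'E FN FZ FFx scalerN scalerA.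
  by rewrite -expr2 sqr_i scaleN1r opprK.
have V'V : V' \co V = bop_id H.
  apply: bop_ext => x; rewrite bopC VE V'E FZ FFx scalerA.
  by rewrite -expr2 sqr_i scaleN1r opprK.
have VV : invertible_bop V by exists V'.
have V'i : invertible_bop V' by exists V.
have -> : U = V \co (V' \co U) by rewrite -bop_compA VV'; exact: bop_ext.
have skew x y : rip ('i *: F x) y = - rip x ('i *: F y).
  by rewrite ripil Fs FZ.
apply: component_comp => //.
  apply: component_nonneg => // x; rewrite VE.
  by have := skew x x; rewrite [rip x _]ripC; lra.
apply: component_nonneg => [|x]; first exact: invertible_comp.
have := FB x; have /commute_bopE {}UF := UF.
rewrite !bopC V'E BE !FZ linearB/= scalerBr ripZl ripBl ripNl.
rewrite [rip ('i *: F (U' x)) x]skew U'adj.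
rewrite (_ : U ('i *: F x) = 'i *: F (U x)); last by rewrite linearZ/= UF.
by rewrite [rip x _]ripC; lra.
Qed.

(** The factors of the polar decomposition of [e T] are joined to the identity,
    where the scalar [e > 0] makes [e T] a contraction, as is needed to extract
    the square root of its Gram operator. *)
Theorem general_linear_connected : connected (general_linear H).
Proof.
apply: connected_of_component => T TV.
pose e := (rnorm T + 1)^-1.
have k0 : 0 < rnorm T + 1 by rewrite ltr_wpDl ?rnorm_ge0.
have e0 : 0 < e by rewrite invr_gt0.
pose T1 : bop H H := e%:C *: T.
have scal (a : R) : 0 < a -> invertible_bop (a%:C *: bop_id H) /\
    connected_component (general_linear H) (bop_id H) (a%:C *: bop_id H).
  move=> a0; have aV : invertible_bop (a%:C *: bop_id H).
    apply: (accretive_invertible a0) => x; by rewrite bopZ bop1 ripZl.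
  split=> //; apply: component_nonneg => // x.
  by rewrite bopZ bop1 ripZl mulr_ge0 ?rip_ge0 ?ltW.
have T1V : invertible_bop T1.
  have -> : T1 = (e%:C *: bop_id H) \co T by exact: bop_ext.
  by apply: invertible_comp => //; have [] := scal _ e0.
have -> : T = ((rnorm T + 1)%:C *: bop_id H) \co T1.
  apply: bop_ext => x; rewrite bopC !bopZ bop1 scalerA -rmorphM/=.
  by rewrite mulfV ?gt_eqF// scale1r.
have [kV k1] := scal _ k0; apply: component_comp => //.
have T1c x : rip (T1 x) (T1 x) <= rip x x.
  apply: (proj1 (contraction_rip T1)) => {}x.
  rewrite bopZ rnormZ gtr0_norm// mulrC ler_pdivrMr//.
  rewrite (le_trans (bopK _ _))// [leRHS]mulrC ler_wpM2r ?rnorm_ge0//.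
  by rewrite lerDl.
clearbody T1; move: {T TV e k0 e0 kV k1} T1 T1V T1c => T TV Tc.
pose A := adjoint T \co T.
have As x y : rip (A x) y = rip (T x) (T y) by rewrite bopC rip_adjointV.
have As' x y : rip x (A y) = rip (T x) (T y) by rewrite ripC As ripC.
have AA x : rip (A x) (A x) <= rip (T x) (T x).
  have T1 : rnorm T <= 1 by apply/contraction_rnorm/contraction_rip.
  rewrite -[leRHS]mul1r -(expr1n _ 2) -rnorm_sqr_le//.
  rewrite (le_trans (rnorm_adjoint_le _ _))//.
  by rewrite ler_wpM2r ?rnorm_ge0.
have AV : invertible_bop A.
  by apply: invertible_comp => //; exact: invertible_adjoint.
clearbody A.
have [||S [Ss S0 SS _]] := @square_root_exists _ _ (bop_id H - A).
- by move=> x y; rewrite !bopB ripBl ripBr As As'.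
- apply/contraction_rip => x; rewrite bopB bop1 ripBl !ripBr As As'.
  by have := AA x; have := rip_ge0 (T x); lra.
have {}SS x : S (S x) = A x.
  by rewrite -bopC SS !bopB bop1 opprB addrC subrK.
have SV : invertible_bop S.
  apply: (@invertible_of_left_right _ _ _ (bop_inv A \co S) (S \co bop_inv A)).
    by apply: bop_ext => x; rewrite !bopC SS bop_invK.
  by apply: bop_ext => x; rewrite !bopC SS bop_invVK.
have -> : T = (T \co bop_inv S) \co S.
  by apply: bop_ext => x; rewrite !bopC bop_invK.
have UV : invertible_bop (T \co bop_inv S).
  by apply: invertible_comp => //; exact: invertible_inv.
apply: component_comp => //; last exact: component_nonneg.
apply: component_unitary => // x y.
by rewrite !bopC -As -SS Ss !bop_invVK.
Qed.

End GeneralLinear.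

(** * Differentials and biholomorphic mappings *)

Section Calculus.
Variables (R : realType).

Section Differentials.
Variables (V W : normedModType R[i]).

(** A quadratic bound on the remainder is all that the mappings below need:
    they are built from products and inverses of operators. *)
Lemma is_diff_quadratic (f L : V -> W) (x : V) (M C e : R) :
  linear L -> (forall h, rnorm (L h) <= M * rnorm h) -> 0 < e ->
  (forall h, rnorm h < e ->
    rnorm (f (h + x) - f x - L h) <= C * rnorm h ^+ 2) ->
  is_diff x f L.
Proof.
move=> Ll LM e0 fC.
pose B : bop V W := Bop (bop_of_bound Ll LM).
have dxf : f \o shift x = cst (f x) + (B : V -> W) +o_ 0 id.
  apply/eqaddoP => d d0.
  have [r re] : exists r : R, d = r%:C.
    by apply/complex_realP; rewrite gtr0_real.
  have r0 : 0 < r by rewrite -ltcR -re.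
  have C1 : 0 < `|C| + 1 by rewrite ltr_wpDl.
  apply/nbhs_rnormP; exists (Num.min e (r / (`|C| + 1))).
    by rewrite lt_min e0 divr_gt0.
  move=> h; rewrite subr0 lt_min => /andP[he hr].
  rewrite /= [leLHS]rnormE [`|h|]rnormE re -rmorphM lecR.
  have -> : (f \o shift x - (cst (f x) + (B : V -> W))) h =
      f (h + x) - f x - L h by rewrite -addrA -opprD.
  apply: le_trans (fC _ he) _; rewrite expr2 mulrA ler_wpM2r ?rnorm_ge0//.
  move: hr; rewrite ltr_pdivlMr// => hr.
  apply: le_trans (ltW hr); rewrite mulrC ler_wpM2l ?rnorm_ge0//.
  by rewrite (le_trans (ler_norm _))// lerDl.
have dB : 'd f x = B :> (V -> W).
  by apply: diff_unique dxf; exact: bop_continuous.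
apply: DiffDef; last exact: dB.
by apply/diff_locallyP; rewrite dB; split=> //; exact: bop_continuous.
Qed.

Lemma is_diff_bop (T : bop V W) x : is_diff x T T.
Proof.
apply: (@is_diff_quadratic _ _ x (rnorm T) 0 1) => // [|h|h _].
- exact: bop_linear.
- exact: bopK.
- by rewrite linearD addrK subrr rnorm0 mul0r.
Qed.

End Differentials.

Section Products.
Variables (V W : normedModType R[i]).

Lemma rnorm_fst_le (h : V * W) : rnorm h.1 <= rnorm h.
Proof. by rewrite rnorm_le -rnormE num_le_max lexx. Qed.

Lemma rnorm_snd_le (h : V * W) : rnorm h.2 <= rnorm h.
Proof. by rewrite rnorm_le -rnormE num_le_max lexx orbT. Qed.

Lemma fst_bounded : fst \in @bounded_linear R (V * W)%type V.
Proof.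
by apply: (bop_of_bound (M := 1)) => // h; rewrite mul1r rnorm_fst_le.
Qed.

Lemma snd_bounded : snd \in @bounded_linear R (V * W)%type W.
Proof.
by apply: (bop_of_bound (M := 1)) => // h; rewrite mul1r rnorm_snd_le.
Qed.

Lemma is_diff_fst (p : V * W) : is_diff p fst fst.
Proof. exact: (is_diff_bop (Bop fst_bounded) p). Qed.

Lemma is_diff_snd (p : V * W) : is_diff p snd snd.
Proof. exact: (is_diff_bop (Bop snd_bounded) p). Qed.

End Products.

Lemma is_diff_mul (U V W : normedModType R[i]) (p : bop V W * bop U V) :
  is_diff p (fun q : bop V W * bop U V => q.1 \co q.2)
    (fun h => h.1 \co p.2 + p.1 \co h.2).
Proof.
apply: (@is_diff_quadratic _ _ _ _ _ (rnorm p.1 + rnorm p.2) 1 1) => //.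
- move=> a h k; apply: bop_ext => x; rewrite !(bopD, bopZ, bopC)/= linearP.
  by rewrite scalerDr addrACA.
- move=> h; apply: le_trans (rnormD _ _) _; rewrite mulrDl addrC lerD//.
    apply: le_trans (rnorm_comp _ _) _.
    by rewrite ler_wpM2l ?rnorm_ge0 ?rnorm_snd_le.
  apply: le_trans (rnorm_comp _ _) _; rewrite mulrC.
  by rewrite ler_wpM2l ?rnorm_ge0 ?rnorm_fst_le.
- move=> h _; rewrite (_ : _ - _ - _ = h.1 \co h.2); last first.
    case: h p => h k [S T] /=; apply: bop_ext => x.
    rewrite !bopB [(h \co T + _) x]bopD !bopC.
    rewrite [(h + S) _]bopD [(k + T) x]bopD !linearD/=.
    by rewrite -opprD [_ + (_ + S _)]addrA addrK -[X in X - _]addrA addrK.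
  apply: le_trans (rnorm_comp _ _) _; rewrite mul1r expr2.
  by rewrite ler_pM ?rnorm_ge0 ?rnorm_fst_le ?rnorm_snd_le.
Qed.

Lemma is_diff_comp_bop (X U V W : normedModType R[i])
    (F dF : X -> bop V W) (G dG : X -> bop U V) x :
  is_diff x F dF -> is_diff x G dG ->
  is_diff x (fun y => F y \co G y) (fun h => dF h \co G x + F x \co dG h).
Proof.
move=> Fx Gx; have FGx := is_diff_pair Fx Gx.
exact: (@is_diff_comp _ _ _ _ _ _ _ _ _ FGx (is_diff_mul (F x, G x))).
Qed.

Section InverseDifferential.
Variable H : hilbertType R.
Implicit Types T : bop H H.

(** With [T'] and [N] the inverses of [T] and [T + h], the resolvent identity
    [N = T' - T' h N], used twice, turns the remainder into [T' h T' h N], which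
    is quadratic because [|N| <= 2 |T'|] when [|T'| |h| <= 1 / 2]. *)
Lemma is_diff_inv T : invertible_bop T ->
  is_diff T (@bop_inv R H) (fun h => - (bop_inv T \co h \co bop_inv T)).
Proof.
move=> TV; set T' := bop_inv T; set t := rnorm T'.
have t0 : 0 <= t by exact: rnorm_ge0.
have t1 : 0 < t + 1 by rewrite ltr_wpDl.
apply: (@is_diff_quadratic _ _ _ _ _ (t * t) (t * t * (t *+ 2))
  (t *+ 2 + 2)^-1).
- move=> a h k; apply: bop_ext => x.
  by rewrite !(bopN, bopD, bopZ, bopC) linearP opprD scalerN.
- move=> h; rewrite rnormN (le_trans (rnorm_comp _ _))// mulrC.
  by rewrite -mulrA ler_wpM2l// rnorm_comp.
- by rewrite invr_gt0 -[2]/(1 *+ 2) -mulrnDl pmulrn_lgt0.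
move=> h; rewrite -[X in _ < X]mul1r ltr_pdivlMr; last first.
  by rewrite -[2]/(1 *+ 2) -mulrnDl pmulrn_lgt0.
move=> h1; have ht : t * rnorm h <= 2^-1.
  have := rnorm_ge0 h; nra.
have ThV : invertible_bop (h + T).
  by rewrite addrC; apply: invertible_perturb => //; rewrite -/T' -/t; lra.
set N := bop_inv (h + T).
have NE : N = T' - T' \co h \co N.
  apply: bop_ext => x; rewrite bopB !bopC.
  rewrite -{2}(bop_invVK x ThV) -/N bopD linearD/= [T' (T _)]bop_invK//.
  by rewrite [_ + N x]addrC addrK.
have Nt : rnorm N <= t *+ 2.
  have : rnorm N <= t + rnorm (T' \co h \co N) by rewrite {1}NE rnormB.
  have : rnorm (T' \co h \co N) <= rnorm N * 2^-1.
    rewrite (le_trans (rnorm_comp _ _))// mulrC ler_wpM2l ?rnorm_ge0//.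
    exact: le_trans (rnorm_comp _ _) ht.
  lra.
have NEx x : T' (h (N x)) = T' x - N x.
  have Nx : N x = T' x - T' (h (N x)) by rewrite [in LHS]NE.
  by rewrite [in RHS]Nx opprB addrC subrK.
have -> : N - T' - - (T' \co h \co T') = T' \co h \co (T' \co h \co N).
  apply: bop_ext => x; rewrite 2!bopB bopN !bopC NEx opprK !linearB/= NEx.
  by rewrite opprB [RHS]addrC.
rewrite (le_trans (rnorm_comp _ _))//.
have -> : t * t * (t *+ 2) * rnorm h ^+ 2 =
   (t * rnorm h) * (t * rnorm h * (t *+ 2)) by ring.
rewrite ler_pM ?rnorm_ge0 ?rnorm_comp//.
rewrite (le_trans (rnorm_comp _ _))//.
by rewrite ler_pM ?rnorm_ge0 ?rnorm_comp.
Qed.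

End InverseDifferential.

End Calculus.

Section Biholomorphic.
Variables (R : realType).

Lemma biholomorphic_of_inverse (V W : normedModType R[i]) (D : set V)
    (E : set W) (f : V -> W) (g : W -> V) :
  holomorphic D f -> holomorphic E g ->
  (forall x, D x -> E (f x) /\ g (f x) = x) ->
  (forall y, E y -> D (g y) /\ f (g y) = y) -> biholomorphic D E f.
Proof.
move=> fh gh fg gf; split=> //.
  split=> [x /fg[]//|x y /set_mem/fg[_ fx] /set_mem/fg[_ fy] fxy|y /gf[gy yE]].
    by rewrite -fx fxy.
  by exists (g y).
by exists g; split=> // x /fg[].
Qed.

Lemma biholomorphic_inverse (V W : normedModType R[i]) (D : set V)
    (E : set W) (f : V -> W) :
  biholomorphic D E f -> exists2 g, biholomorphic E D g &
   (forall x, D x -> E (f x) /\ g (f x) = x) /\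
   (forall y, E y -> D (g y) /\ f (g y) = y).
Proof.
move=> [fh [fD _ fE] [g [gh gf]]].
have h1 x : D x -> E (f x) /\ g (f x) = x.
  by move=> Dx; split; [exact: fD|exact: gf].
have h2 y : E y -> D (g y) /\ f (g y) = y.
  by move=> /fE[x Dx <-]; rewrite gf.
exists g; last by [].
exact: biholomorphic_of_inverse h2 h1.
Qed.

Lemma biholomorphic_comp (U V W : normedModType R[i]) (D : set U) (E : set V)
    (F : set W) (f : U -> V) (g : V -> W) :
  biholomorphic D E f -> biholomorphic E F g -> biholomorphic D F (g \o f).
Proof.
move=> fb gb; have [f' [f'h _ _] [f1 f2]] := biholomorphic_inverse fb.
have [g' [g'h _ _] [g1 g2]] := biholomorphic_inverse gb.
have [fh _ _] := fb; have [gh _ _] := gb.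
apply: (@biholomorphic_of_inverse _ _ _ _ _ (f' \o g')) =>
  [x Dx|y Fy|x Dx|y Fy].
- by apply: differentiable_comp; [exact: fh|apply: gh; case: (f1 _ Dx)].
- by apply: differentiable_comp; [exact: g'h|apply: f'h; case: (g2 _ Fy)].
- by have [Ef fx] := f1 _ Dx; have [Fg gx] := g1 _ Ef; rewrite /= gx.
- by have [Eg gy] := g2 _ Fy; have [Df fy] := f2 _ Eg; rewrite /= fy.
Qed.

End Biholomorphic.

(** * The domain and its product model *)

Section DirectSumTools.
Variables (R : realType) (U V : hilbertType R).

Lemma dsum_inl_bounded :
  (fun u => (u, 0) : dsum U V) \in @bounded_linear R U (dsum U V).
Proof.
apply: (bop_of_bound (M := 1)) => [a u v|u].
  by apply/pair_equal_spec; rewrite /= scaler0 addr0.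
rewrite mul1r rnorm_le -rnormE; apply: le_trans (dsum_norm_le _) _.
by rewrite /= normr0 addr0.
Qed.

Lemma dsum_inr_bounded :
  (fun v => (0, v) : dsum U V) \in @bounded_linear R V (dsum U V).
Proof.
apply: (bop_of_bound (M := 1)) => [a u v|v].
  by apply/pair_equal_spec; rewrite /= scaler0 addr0.
rewrite mul1r rnorm_le -rnormE; apply: le_trans (dsum_norm_le _) _.
by rewrite /= normr0 add0r.
Qed.

Definition dsum_inl : bop U (dsum U V) := Bop dsum_inl_bounded.
Definition dsum_inr : bop V (dsum U V) := Bop dsum_inr_bounded.

Lemma rip_dsum (u v : dsum U V) : rip u v = rip u.1 v.1 + rip u.2 v.2.
Proof. exact: ReD. Qed.

End DirectSumTools.

Section Domain.
Variables (R : realType) (H K : hilbertType R).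
Local Notation A := (bop H (dsum K H)).
Implicit Types (Z : A) (W : bop H K) (S T P : bop H H).

Definition top_row Z : bop H K := dsum_fst K H \co Z.
Definition bottom_row Z : bop H H := dsum_snd K H \co Z.
Definition block W T : A := dsum_inl K H \co W + dsum_inr K H \co T.

Lemma blockE W T x : block W T x = (W x, T x) :> dsum K H.
Proof.
by rewrite /block bopD; apply/pair_equal_spec; rewrite /= addr0 add0r.
Qed.

Lemma top_block W T : top_row (block W T) = W.
Proof. by apply: bop_ext => x; rewrite /= addr0. Qed.

Lemma bottom_block W T : bottom_row (block W T) = T.
Proof. by apply: bop_ext => x; rewrite /= add0r. Qed.

Lemma block_rows Z : block (top_row Z) (bottom_row Z) = Z.
Proof.
apply: bop_ext => x; rewrite /block bopD /=.
by case: (Z x) => u v; apply/pair_equal_spec; rewrite /= addr0 add0r.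
Qed.

(** The strict inequality [Z1^* Z1 < Z2^* Z2] in uniform form, in which its
    invariance under isometries of the indefinite form is immediate. *)
Definition coercive Z := exists2 c : R, 0 < c &
  forall x, rip (top_row Z x) (top_row Z x) + c * rip x x
    <= rip (bottom_row Z x) (bottom_row Z x).

(** For a positive [P], nonnegativity of the form of [P] at [x - t P x] with
    [t = 1 / m] and [m > |P|] bounds [|P x| ^ 2] by [m] times the value of the
    form at [x]. *)
Lemma nonneg_invertible_coercive P : symmetric_bop P -> nonneg_bop P ->
  invertible_bop P ->
  exists2 c : R, 0 < c & forall x, c * rip x x <= rip (P x) x.
Proof.
move=> Ps P0 PV; pose m := rnorm P + 1; pose k := rnorm (bop_inv P) + 1.
have m0 : 0 < m by rewrite ltr_wpDl ?rnorm_ge0.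
have k0 : 0 < k by rewrite ltr_wpDl ?rnorm_ge0.
exists (m * k ^+ 2)^-1; first by rewrite invr_gt0 mulr_gt0 ?exprn_gt0.
move=> x; rewrite mulrC ler_pdivrMr ?mulr_gt0 ?exprn_gt0//.
have xP : rip x x <= k ^+ 2 * rip (P x) (P x).
  rewrite -rnorm_sqr_le ?(ltW k0)// -{1}(bop_invK x PV).
  by rewrite (le_trans (bopK _ _))// ler_wpM2r ?rnorm_ge0// lerDl.
have Pm y : rip (P y) y <= m * rip y y.
  rewrite (le_trans (rip_le _ _))// rip_norm expr2 mulrA ler_wpM2r ?rnorm_ge0//.
  by rewrite (le_trans (bopK _ _))// ler_wpM2r ?rnorm_ge0// lerDl.
have Px : rip (P x) (P x) <= m * rip (P x) x.
  have := P0 (x - m^-1%:C *: P x).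
  rewrite linearB linearZ/= ripBl !ripBr !ripZl !ripZr [rip (P (P x)) x]Ps.
  have := Pm (P x); set u := rip (P (P x)) (P x); set v := rip (P x) (P x).
  set w := rip (P x) x => uv.
  rewrite -ler_pdivrMl//.
  have : m^-1 * (m^-1 * u) <= m^-1 * v.
    by rewrite ler_pM2l ?invr_gt0// ler_pdivrMl.
  lra.
apply: le_trans xP _.
rewrite (_ : _ * (m * _) = k ^+ 2 * (m * rip (P x) x)); last by ring.
by rewrite ler_pM2l ?exprn_gt0.
Qed.

Lemma rip_gram (U V : hilbertType R) (T : bop U V) x y :
  rip ((adjoint T \co T) x) y = rip (T x) (T y).
Proof. by rewrite bopC rip_adjointV. Qed.

Lemma inner_gram (U V : hilbertType R) (T : bop U V) x :
  inner ((adjoint T \co T) x) x = (rip (T x) (T x))%:C.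
Proof.
rewrite innerC bopC -adjointP inner_norm rnormE rip_norm -rmorphXn/=.
exact: conjc_real.
Qed.

Lemma domainDP Z :
  domainD H K Z <-> coercive Z /\ invertible_bop (bottom_row Z).
Proof.
rewrite /domainD /= -/(top_row Z) -/(bottom_row Z).
set Z1 := top_row Z; set Z2 := bottom_row Z.
set P := adjoint Z2 \co Z2 - adjoint Z1 \co Z1.
have PE x y : rip (P x) y = rip (Z2 x) (Z2 y) - rip (Z1 x) (Z1 y).
  by rewrite bopB ripBl !rip_gram.
split=> [[[P0 PV] Z2V]|[[c c0 Zc] Z2V]]; split=> //.
  have [|x|c c0 Pc] := nonneg_invertible_coercive _ _ PV.
  - by move=> x y; rewrite PE [RHS]ripC PE; congr (_ - _); exact: ripC.
  - by have := P0 x; rewrite lecE => /andP[].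
  - by exists c => // x; have := Pc x; rewrite PE lerBrDr addrC.
have Pc x : c * rip x x <= rip (P x) x by rewrite PE lerBrDr addrC Zc.
split; last exact: accretive_invertible c0 Pc.
move=> x; rewrite bopB linearBl/= !inner_gram -rmorphB/= ler0c -PE.
by apply: le_trans (Pc x); rewrite mulr_ge0 ?rip_ge0 ?ltW.
Qed.

Definition quotient Z : bop H K := top_row Z \co bop_inv (bottom_row Z).

Lemma coercive_quotient Z : invertible_bop (bottom_row Z) ->
  coercive Z <-> rnorm (quotient Z) < 1.
Proof.
move=> ZV; split=> [[c c0 Zc]|].
  pose m := rnorm (bottom_row Z) + 1.
  have m0 : 0 < m by rewrite ltr_wpDl ?rnorm_ge0.
  (* The minimum with [1] keeps the bound [1 - k / 2] nonnegative, also when [H]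
     is trivial and [c] is arbitrary. *)
  pose k : R := Num.min (c / m ^+ 2) 1.
  have k0 : 0 < k by rewrite lt_min ltr01 divr_gt0 ?exprn_gt0.
  have k1 : k <= 1 by rewrite ge_min lexx orbT.
  have kc : k * m ^+ 2 <= c.
    by rewrite -ler_pdivlMr ?exprn_gt0// ge_min lexx.
  apply: (@le_lt_trans _ _ (1 - k / 2)); last by lra.
  apply: rnorm_bop_le => [|y]; first by lra.
  rewrite rnorm_sqr_le; last by lra.
  have := Zc (bop_inv (bottom_row Z) y); rewrite bop_invVK//.
  have : rip y y <= m ^+ 2 *
      rip (bop_inv (bottom_row Z) y) (bop_inv (bottom_row Z) y).
    rewrite -rnorm_sqr_le ?(ltW m0)// -{1}(bop_invVK y ZV).
    by rewrite (le_trans (bopK _ _))// ler_wpM2r ?rnorm_ge0// lerDl.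
  rewrite -[quotient Z y]/(top_row Z (bop_inv (bottom_row Z) y)).
  move: (rip_ge0 (bop_inv (bottom_row Z) y)).
  set p := rip (bop_inv _ _) _; set q := rip y y; set r := rip (top_row _ _) _.
  move=> p0 qm rq.
  have h1 : k * q <= c * p.
    apply: le_trans (_ : k * (m ^+ 2 * p) <= _); first by rewrite ler_pM2l.
    by rewrite mulrA ler_wpM2r.
  have h2 : 0 <= (k / 2) ^+ 2 * q by rewrite mulr_ge0 ?sqr_ge0 ?rip_ge0.
  rewrite (_ : (1 - k / 2) ^+ 2 * q = q - k * q + (k / 2) ^+ 2 * q).
    lra.
  by field.
set W := quotient Z => W1.
pose m := rnorm (bop_inv (bottom_row Z)) + 1.
have m0 : 0 < m by rewrite ltr_wpDl ?rnorm_ge0.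
have w0 : 0 <= rnorm W by exact: rnorm_ge0.
have w2 : rnorm W ^+ 2 < 1 by rewrite expr_lt1.
exists ((1 - rnorm W ^+ 2) / m ^+ 2) => [|x].
  by rewrite divr_gt0 ?exprn_gt0// subr_gt0.
have h1 : rip (top_row Z x) (top_row Z x) <=
    rnorm W ^+ 2 * rip (bottom_row Z x) (bottom_row Z x).
  rewrite -rnorm_sqr_le// -{1}(bop_invK x ZV).
  exact: (bopK W).
have h2 : rip x x <= m ^+ 2 * rip (bottom_row Z x) (bottom_row Z x).
  rewrite -rnorm_sqr_le ?(ltW m0)// -{1}(bop_invK x ZV).
  by rewrite (le_trans (bopK _ _))// ler_wpM2r ?rnorm_ge0// lerDl.
have h3 : (1 - rnorm W ^+ 2) / m ^+ 2 * rip x x <=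
   (1 - rnorm W ^+ 2) * rip (bottom_row Z x) (bottom_row Z x).
  rewrite -mulrA ler_pM2l ?subr_gt0// mulrC ler_pdivrMr ?exprn_gt0//.
  by rewrite mulrC.
by lra.
Qed.

Lemma domainD_quotient Z :
  domainD H K Z <-> rnorm (quotient Z) < 1 /\ invertible_bop (bottom_row Z).
Proof.
by rewrite domainDP; split=> -[h ZV]; split=> //; apply/(coercive_quotient ZV).
Qed.

Definition to_product Z : bop H K * bop H H := (quotient Z, bottom_row Z).
Definition of_product (p : bop H K * bop H H) : A := block (p.1 \co p.2) p.2.

Lemma domainD'E p :
  domainD' H K p <-> rnorm p.1 < 1 /\ invertible_bop p.2.
Proof. by rewrite rnorm_lt. Qed.

Lemma to_productP Z : domainD H K Z <-> domainD' H K (to_product Z).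
Proof. by rewrite domainD_quotient domainD'E. Qed.

Lemma to_productK Z : domainD H K Z -> of_product (to_product Z) = Z.
Proof.
move=> /domainD_quotient[_ ZV]; rewrite -[RHS]block_rows; congr (block _ _).
by apply: bop_ext => x; rewrite !bopC bop_invK.
Qed.

Lemma of_productK p : domainD' H K p -> to_product (of_product p) = p.
Proof.
move=> /domainD'E[_ pV]; rewrite /to_product /quotient top_block bottom_block.
case: p pV => W T /= TV; congr (_, _); apply: bop_ext => x.
by rewrite !bopC bop_invVK.
Qed.

Lemma of_productP p : domainD' H K p -> domainD H K (of_product p).
Proof. by move=> pD; apply/to_productP; rewrite of_productK. Qed.

Definition d_to_product Z (h : A) : bop H K * bop H H :=
  (top_row h \co bop_inv (bottom_row Z) +
     top_row Z \co - (bop_inv (bottom_row Z) \co bottom_row h \co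
       bop_inv (bottom_row Z)),
   bottom_row h).

Lemma is_diff_to_product Z : invertible_bop (bottom_row Z) ->
  is_diff Z to_product (d_to_product Z).
Proof.
move=> ZV; apply: is_diff_pair;
  last exact: (is_diff_bop (bop_lmul H (dsum_snd K H)) Z).
apply: is_diff_comp_bop;
  first exact: (is_diff_bop (bop_lmul H (dsum_fst K H)) Z).
exact: (@is_diff_comp _ _ _ _ bottom_row _ _ _ Z
  (is_diff_bop (bop_lmul H (dsum_snd K H)) Z) (is_diff_inv ZV)).
Qed.

Definition d_of_product (p h : bop H K * bop H H) : A :=
  block (h.1 \co p.2 + p.1 \co h.2) h.2.

Lemma block_bounded : (fun p : bop H K * bop H H => block p.1 p.2)
  \in @bounded_linear R (bop H K * bop H H)%type A.
Proof.
apply: (bop_of_bound (M := rnorm (dsum_inl K H) + rnorm (dsum_inr K H))).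
  move=> a p q; apply: bop_ext => x.
  rewrite -[RHS]/(a *: block p.1 p.2 x + block q.1 q.2 x) !blockE.
  by [].
move=> p; rewrite /block (le_trans (rnormD _ _))// mulrDl lerD//.
  apply: le_trans (rnorm_comp _ _) _.
  by rewrite ler_wpM2l ?rnorm_ge0// rnorm_fst_le.
apply: le_trans (rnorm_comp _ _) _.
by rewrite ler_wpM2l ?rnorm_ge0// rnorm_snd_le.
Qed.

Lemma is_diff_of_product p : is_diff p of_product (d_of_product p).
Proof.
have h1 := is_diff_pair (is_diff_mul p) (is_diff_snd p).
exact: (@is_diff_comp _ _ _ _ _ _ _ _ p h1 (is_diff_bop (Bop block_bounded) _)).
Qed.

Lemma biholomorphic_to_product :
  biholomorphic (domainD H K) (domainD' H K) to_product.
Proof.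
apply: (@biholomorphic_of_inverse _ _ _ _ _ _ of_product).
- move=> Z /domainD_quotient[_ ZV].
  exact: (@ex_diff _ _ _ _ _ _ _ (is_diff_to_product ZV)).
- by move=> p _; exact: (@ex_diff _ _ _ _ _ _ _ (is_diff_of_product p)).
- by move=> Z ZD; split; [exact/to_productP|exact: to_productK].
- by move=> p pD; split; [exact: of_productP|exact: of_productK].
Qed.

Lemma domain_D' : domain (domainD' H K).
Proof.
have p0 : domainD' H K (0, bop_id H).
  by apply/domainD'E; rewrite rnorm0 ltr01; split=> //; exact: invertible_id.
split; first by exists (0, bop_id H).
- rewrite openE => p /domainD'E[p1 p2]; apply/nbhs_rnormP.
  have /nbhs_rnormP[e e0 eV] : nbhs p.2 (general_linear H).
    by have := @invertible_open R H; rewrite openE; exact.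
  exists (Num.min e (1 - rnorm p.1)); first by rewrite lt_min e0 subr_gt0.
  move=> q; rewrite lt_min => /andP[qe q1]; apply/domainD'E; split.
    have := rnorm_fst_le (q - p); have := rnormD (q - p).1 p.1.
    by rewrite [(q - p).1 + _]subrK; lra.
  by apply: eV; apply: le_lt_trans qe; exact: (rnorm_snd_le (q - p)).
- apply: (@connected_of_component _ _ (0, bop_id H)).
  move=> -[W T] /domainD'E[/= W1 TV].
  apply: (@connected_component_trans _ _ (0, T)).
    apply: (@component_image _ _ (general_linear H) _ (fun T => (0, T))).
    + move=> S; apply: (@cvg_pair _ _ _ (nbhs S) (nbhs (0 : bop H K)) (nbhs S)
        _ _ _ (fun=> 0) id); last exact: cvg_id.
      exact: cvg_cst.
    + by move=> S SV; apply/domainD'E; rewrite rnorm0 ltr01.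
    + rewrite connected_component_id//; first exact: invertible_id.
      exact: general_linear_connected.
  apply: component_segment => t /andP[t0 t1]; apply/domainD'E; split => /=.
    rewrite scaler0 add0r rnormZ ger0_norm//; apply: le_lt_trans W1.
    by rewrite -[leRHS]mul1r ler_wpM2r ?rnorm_ge0.
  by rewrite -scalerDl -rmorphD/= subrK scale1r.
Qed.

Lemma domain_D : domain (domainD H K).
Proof.
have [[p pD'] D'o D'c] := domain_D'.
split; first by exists (of_product p); exact: of_productP.
- rewrite openE => Z ZD.
  have [_ ZV] := proj1 (domainD_quotient Z) ZD.
  have fZ : {for Z, continuous to_product}.
    apply: differentiable_continuous.
    exact: (@ex_diff _ _ _ _ _ _ _ (is_diff_to_product ZV)).
  have : nbhs (to_product Z) (domainD' H K).
    by apply: open_nbhs_nbhs; split=> //; exact/to_productP.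
  move=> /fZ pre; suff -> : domainD H K = to_product @^-1` domainD' H K by [].
  by apply/seteqP; split=> Y /to_productP.
- have -> : domainD H K = of_product @` domainD' H K.
    apply/seteqP; split=> [Z ZD|_ [q qD <-]]; last exact: of_productP.
    by exists (to_product Z); [exact/to_productP|exact: to_productK].
  apply: connected_continuous_connected D'c _; apply: continuous_subspaceT => q.
  apply: differentiable_continuous.
  exact: (@ex_diff _ _ _ _ _ _ _ (is_diff_of_product q)).
Qed.

End Domain.

(** * Linear automorphisms and symmetries *)

Section Cayley.
Variables (R : realType) (H K : hilbertType R).
Local Notation D2 := (dsum K H).
Local Notation A := (bop H (dsum K H)).
Implicit Types (Z : A) (B W : bop H K) (S T : bop H H) (z w : D2).

Definition off_diag B : bop D2 D2 :=
  dsum_inl K H \co B \co dsum_snd K H +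
  dsum_inr K H \co adjoint B \co dsum_fst K H.

Lemma off_diagE B z : off_diag B z = (B z.2, adjoint B z.1) :> D2.
Proof.
by rewrite /off_diag bopD; apply/pair_equal_spec; rewrite /= addr0 add0r.
Qed.

Definition cayley B : bop D2 D2 :=
  (bop_id D2 + off_diag B) \co bop_inv (bop_id D2 - off_diag B).

Lemma adjointN B : adjoint (- B) = - adjoint B.
Proof.
apply: bop_ext => x; apply: rip_eq => y.
by rewrite bopN ripNl !rip_adjointV ripNr.
Qed.

Lemma off_diag_invertible B : rnorm B < 1 ->
  invertible_bop (bop_id D2 - off_diag B).
Proof.
move=> B1; apply: (@accretive_invertible _ _ _ (1 - rnorm B)).
  by rewrite subr_gt0.
move=> z; rewrite bopB bop1 ripBl mulrBl mul1r lerD2l lerN2 off_diagE.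
rewrite !rip_dsum /= rip_adjointV [rip z.1 _]ripC.
have h : rip (B z.2) z.1 <= rnorm B * (rnorm z.2 * rnorm z.1).
  rewrite (le_trans (rip_le _ _))// mulrA ler_wpM2r ?rnorm_ge0//.
  exact: bopK.
have h2 : rnorm z.2 * rnorm z.1 *+ 2 <= rnorm z.1 ^+ 2 + rnorm z.2 ^+ 2.
  by have := sqr_ge0 (rnorm z.1 - rnorm z.2); rewrite sqrrB; lra.
have h3 : rnorm B * (rnorm z.2 * rnorm z.1 *+ 2) <=
    rnorm B * (rnorm z.1 ^+ 2 + rnorm z.2 ^+ 2).
  by rewrite ler_wpM2l ?rnorm_ge0.
rewrite !rip_norm; move: h3; rewrite mulrnAr; lra.
Qed.

(** The substitution [z = (1 - X) w] makes the transform polynomial in [B]. *)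
Lemma cayley_factor B z : rnorm B < 1 -> exists w,
  z = (w.1 - B w.2, w.2 - adjoint B w.1) /\
  cayley B z = (w.1 + B w.2, w.2 + adjoint B w.1).
Proof.
move=> B1; have XV := off_diag_invertible B1.
exists (bop_inv (bop_id D2 - off_diag B) z); split.
  by rewrite -[LHS](bop_invVK z XV) bopB bop1 off_diagE.
by rewrite /cayley bopC bopD bop1 off_diagE.
Qed.

Lemma cayleyE B w : rnorm B < 1 ->
  cayley B (w.1 - B w.2, w.2 - adjoint B w.1) =
  (w.1 + B w.2, w.2 + adjoint B w.1).
Proof.
move=> B1; rewrite /cayley bopC.
rewrite -[X in bop_inv _ X]/(w - (_, _) : D2) -off_diagE.
rewrite -[w - _]/((bop_id D2 - off_diag B) w) bop_invK.
  by rewrite bopD off_diagE.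
exact: off_diag_invertible.
Qed.

Lemma cayleyNK B z : rnorm B < 1 -> cayley (- B) (cayley B z) = z.
Proof.
move=> B1; have [w [zE ->]] := cayley_factor z B1.
have := @cayleyE (- B) w; rewrite rnormN adjointN !bopN !opprK => ->//.
Qed.

(** The Cayley transform of a self-adjoint operator that anticommutes with the
    grading [J = diag (-1, 1)] preserves the indefinite form of [J]. *)
Lemma cayley_form B z : rnorm B < 1 ->
  rip (cayley B z).2 (cayley B z).2 - rip (cayley B z).1 (cayley B z).1 =
  rip z.2 z.2 - rip z.1 z.1.
Proof.
move=> B1; have [w [-> ->]] /= := cayley_factor z B1.
have cross := rip_adjoint B w.2 w.1; move: (adjoint B w.1) (B w.2) cross => a b.
rewrite !(ripDl, ripDr, ripNl, ripNr) [rip a w.2]ripC [rip w.1 b]ripC => ->.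
ring.
Qed.

Lemma gram_le B x : rip (B x) (B x) <= rnorm B ^+ 2 * rip x x.
Proof. by rewrite -rnorm_sqr_le ?rnorm_ge0// bopK. Qed.

Lemma one_sub_gram_invertible B : rnorm B < 1 ->
  invertible_bop (bop_id H - adjoint B \co B).
Proof.
move=> B1; apply: (@accretive_invertible _ _ _ (1 - rnorm B ^+ 2)).
  by rewrite subr_gt0 expr_lt1// rnorm_ge0.
move=> x; rewrite bopB bop1 ripBl rip_gram mulrBl mul1r lerD2l lerN2.
exact: gram_le.
Qed.

Lemma one_add_gram_invertible B : invertible_bop (bop_id H + adjoint B \co B).
Proof.
apply: (@accretive_invertible _ _ _ 1) => // x.
by rewrite bopD bop1 ripDl rip_gram mul1r lerDl rip_ge0.
Qed.

(** With [V = Z1 Z2^-1], the lower row [M2] of the transform of [Z] satisfies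
    [(1 - B^* B) M2 = (1 + B^* B + 2 B^* V) Z2], and the middle factor has
    real part at least [1 - |V| ^ 2] because
    [|x| ^ 2 + |B x| ^ 2 - 2 |V x| |B x| >= |x| ^ 2 - |V x| ^ 2]. *)
Lemma cayley_domain B Z : rnorm B < 1 -> domainD H K Z ->
  domainD H K (cayley B \co Z).
Proof.
move=> B1 ZD; have [Zc ZV] := proj1 (domainDP Z) ZD.
have V1 : rnorm (quotient Z) < 1 by apply/coercive_quotient.
apply/domainDP; split.
  have [c c0 Zx] := Zc; exists c => // x; have := Zx x.
  have := cayley_form (Z x) B1.
  rewrite -[(Z x).2]/(bottom_row Z x) -[(Z x).1]/(top_row Z x).
  rewrite -[(cayley B _).2]/(bottom_row (cayley B \co Z) x).
  rewrite -[(cayley B _).1]/(top_row (cayley B \co Z) x).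
  lra.
set V := quotient Z in V1 *.
have VZ x : V (bottom_row Z x) = (Z x).1 by rewrite /V bopC bop_invK.
clearbody V.
pose G := bop_id H + adjoint B \co B + (2 : R)%:C *: (adjoint B \co V).
have GV : invertible_bop G.
  apply: (@accretive_invertible _ _ _ (1 - rnorm V ^+ 2)).
    by rewrite subr_gt0 expr_lt1// rnorm_ge0.
  move=> x; rewrite !bopD bop1 bopZ !ripDl ripZl rip_gram bopC rip_adjointV.
  have h1 := gram_le V x.
  have : 0 <= rip (V x + B x) (V x + B x) by exact: rip_ge0.
  rewrite ripDl !ripDr [rip (B x) (V x)]ripC.
  lra.
have -> : bottom_row (cayley B \co Z) =
    bop_inv (bop_id H - adjoint B \co B) \co (G \co bottom_row Z).
  apply: bop_ext => x; apply: (invertible_inj (one_sub_gram_invertible B1)).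
  rewrite [X in _ = _ X]bopC bop_invVK; last exact: one_sub_gram_invertible.
  have [w [wZ wM]] := cayley_factor (Z x) B1.
  have Z1 : (Z x).1 = w.1 - B w.2 by rewrite wZ.
  have Z2 : bottom_row Z x = w.2 - adjoint B w.1 by rewrite -[LHS]/((Z x).2) wZ.
  have M2 : bottom_row (cayley B \co Z) x = w.2 + adjoint B w.1.
    by rewrite -[LHS]/((cayley B (Z x)).2) wM.
  have -> : (G \co bottom_row Z) x = bottom_row Z x +
      adjoint B (B (bottom_row Z x)) + (2 : R)%:C *: adjoint B (Z x).1.
    by rewrite -VZ.
  have -> y : (bop_id H - adjoint B \co B) y = y - adjoint B (B y) by [].
  rewrite M2 Z2 Z1 !linearB !linearD /=.
  rewrite (_ : (2 : R)%:C = 1 + 1) ?rmorphD// scalerDl !scale1r.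
  set a := adjoint B w.1; set b := adjoint B (B w.2); set c := adjoint B (B a).
  rewrite scalerDl scale1r [RHS]addrACA [w.2 - a + _]addrA subrK; congr (_ + _).
  by rewrite opprD addrACA subrr add0r addrC.
apply: invertible_comp; last exact: invertible_comp.
by apply: invertible_inv; exact: one_sub_gram_invertible.
Qed.

Lemma right_mul_domain T Z : invertible_bop T -> domainD H K Z ->
  domainD H K (Z \co T).
Proof.
move=> TV /domainDP[[c c0 Zc] ZV]; apply/domainDP.
have rowE : bottom_row (Z \co T) = bottom_row Z \co T by exact: bop_ext.
split; last by rewrite rowE; exact: invertible_comp.
pose m := rnorm (bop_inv T) + 1.
have m0 : 0 < m by rewrite ltr_wpDl ?rnorm_ge0.
exists (c / m ^+ 2); first by rewrite divr_gt0 ?exprn_gt0.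
move=> x; rewrite rowE bopC; apply: le_trans (Zc (T x)).
rewrite [top_row _ _]/= lerD2l -mulrA ler_pM2l// mulrC ler_pdivrMr ?exprn_gt0//.
rewrite mulrC -rnorm_sqr_le ?(ltW m0)// -{1}(bop_invK x TV).
by rewrite (le_trans (bopK _ _))// ler_wpM2r ?rnorm_ge0// lerDl.
Qed.

(** The equation [W (1 + B^* B) = 2 B] says that [W] is the image of [0] under
    the transform of [B]. It is solved by [B = W (1 + S)^-1] where [S] is the
    square root of [1 - W^* W], for then [B^* B = (1 - S) (1 + S)^-1]. *)
Lemma half_angle W : rnorm W < 1 -> exists2 B, rnorm B < 1 &
  forall y, W (y + adjoint B (B y)) = (2 : R)%:C *: B y.
Proof.
move=> W1; pose P := adjoint W \co W.
have PE x y : rip (P x) y = rip (W x) (W y) by exact: rip_gram.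
have PEr x y : rip x (P y) = rip (W x) (W y) by rewrite ripC PE ripC.
have Ps : symmetric_bop P by move=> x y; rewrite PE PEr.
have Pc : contraction_bop P.
  move=> x; rewrite bopC (le_trans (rnorm_adjoint_le _ _))//.
  apply: (@le_trans _ _ (rnorm (W x))).
    by rewrite ler_piMl ?rnorm_ge0 ?(ltW W1).
  by rewrite (le_trans (bopK _ _))// ler_piMl ?rnorm_ge0 ?(ltW W1).
have [S [Ss S0 SS _]] := square_root_exists Ps Pc.
have SSE x : S (S x) = x - adjoint W (W x) by rewrite -bopC SS.
pose T := bop_id H + S.
have TV : invertible_bop T.
  apply: (@accretive_invertible _ _ _ 1) => // x.
  by rewrite bopD bop1 ripDl mul1r lerDl.
have Tle u : rnorm u <= rnorm (T u).
  rewrite -[leRHS]mul1r rnorm_sqr_le// expr1n mul1r bopD bop1 ripDl !ripDr.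
  by have := S0 u; have := rip_ge0 (S u); rewrite [rip u (S u)]ripC; lra.
have Ts : symmetric_bop T.
  by move=> x y; rewrite !bopD ripDl ripDr Ss.
pose B := W \co bop_inv T.
have B'E y : adjoint B y = bop_inv T (adjoint W y).
  apply: rip_eq => x; rewrite rip_adjointV bopC -rip_adjointV.
  by rewrite (symmetric_inv TV Ts).
exists B.
  apply: le_lt_trans W1; apply: rnorm_bop_le => [|y]; first exact: rnorm_ge0.
  rewrite bopC (le_trans (bopK _ _))// ler_wpM2l ?rnorm_ge0//.
  by rewrite -{2}(bop_invVK y TV).
move=> y; rewrite B'E !bopC -{1}(bop_invVK y TV).
set u := bop_inv T y.
have -> : bop_inv T (adjoint W (W u)) = u - S u.
  apply: (invertible_inj TV); rewrite bop_invVK// bopD bop1 linearB/= SSE.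
  by rewrite addrA subrK opprB addrC subrK.
rewrite bopD bop1 addrACA subrr addr0 linearD/=.
by rewrite (_ : (2 : R)%:C = 1 + 1) ?rmorphD// scalerDl !scale1r.
Qed.

Definition base_point : A := block 0 (bop_id H).

(** The inverse is carried along so that automorphisms can be inverted and
    composed without choosing one. *)
Definition linear_automorphism (D : set A) (L L' : bop A A) :=
  [/\ forall Z, L' (L Z) = Z, forall Z, L (L' Z) = Z,
      forall Z, D Z -> D (L Z) & forall Z, D Z -> D (L' Z)].

Lemma linear_automorphism_sym D L L' :
  linear_automorphism D L L' -> linear_automorphism D L' L.
Proof. by case. Qed.

Lemma linear_automorphism_comp D L1 L1' L2 L2' :
  linear_automorphism D L1 L1' -> linear_automorphism D L2 L2' ->
  linear_automorphism D (L1 \co L2) (L2' \co L1').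
Proof.
move=> [a1 b1 c1 d1] [a2 b2 c2 d2]; split=> Z; rewrite ?bopC.
- by rewrite a1 a2.
- by rewrite b2 b1.
- by move=> /c2/c1.
- by move=> /d1/d2.
Qed.

Lemma linear_automorphism_biholomorphic D L L' :
  linear_automorphism D L L' -> biholomorphic D D L.
Proof.
move=> [a b c d]; apply: (@biholomorphic_of_inverse _ _ _ _ _ _ L').
- by move=> Z _; exact: (@ex_diff _ _ _ _ _ _ _ (is_diff_bop L Z)).
- by move=> Z _; exact: (@ex_diff _ _ _ _ _ _ _ (is_diff_bop L' Z)).
- by move=> Z DZ; split; [exact: c|exact: a].
- by move=> Z DZ; split; [exact: d|exact: b].
Qed.

(** [Z |-> M Z T] with [M] the Cayley transform of the solution [B] of the
    half-angle equation for [W = Y1 Y2^-1]; it sends [(0, 1)] to [Y] for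
    [T = (1 - B^* B) (1 + B^* B)^-1 Y2]. *)
Lemma transitive_from_base Y : domainD H K Y -> exists L L',
  linear_automorphism (domainD H K) L L' /\ L base_point = Y.
Proof.
move=> /domainD_quotient[W1 YV]; have [B B1 BW] := half_angle W1.
have B1' : rnorm (- B) < 1 by rewrite rnormN.
have mV := one_sub_gram_invertible B1; have pV := one_add_gram_invertible B.
pose Q := bop_inv (bop_id H + adjoint B \co B) \co bottom_row Y.
pose T := (bop_id H - adjoint B \co B) \co Q.
have TV : invertible_bop T.
  apply: invertible_comp => //; apply: invertible_comp => //.
  exact: invertible_inv.
pose L : bop A A := bop_lmul H (cayley B) \co bop_rmul D2 T.
pose L' : bop A A := bop_lmul H (cayley (- B)) \co bop_rmul D2 (bop_inv T).
have LE Z x : L Z x = cayley B (Z (T x)) by [].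
have L'E Z x : L' Z x = cayley (- B) (Z (bop_inv T x)) by [].
exists L, L'; split; first split=> Z.
- by apply: bop_ext => x; rewrite L'E LE bop_invVK// cayleyNK.
- apply: bop_ext => x; rewrite LE L'E bop_invK//.
  by have := cayleyNK (Z x) B1'; rewrite opprK.
- by move=> ZD; apply: cayley_domain => //; exact: right_mul_domain.
- move=> ZD; apply: cayley_domain => //; apply: right_mul_domain => //.
  exact: invertible_inv.
apply: bop_ext => x; rewrite LE blockE bop0 bop1; set v := Q x.
have := @cayleyE B (B v, v) B1; rewrite /= subrr.
rewrite -[v - adjoint B (B v)]/(T x) => ->.
have vE : v + adjoint B (B v) = bottom_row Y x.
  by rewrite -[LHS]/((bop_id H + adjoint B \co B) (Q x)) /Q bopC bop_invVK.
rewrite -[in RHS](block_rows Y) blockE vE; congr (_, _).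
have := BW v; rewrite vE /quotient bopC bop_invK// => ->.
by rewrite (_ : (2 : R)%:C = 1 + 1) ?rmorphD// scalerDl !scale1r.
Qed.

Lemma domainD_linearly_transitive : linearly_transitive (domainD H K).
Proof.
move=> Y Z /transitive_from_base[L [L' [LL' LY]]].
move=> /transitive_from_base[M [M' [MM' MZ]]].
have ML := linear_automorphism_comp MM' (linear_automorphism_sym LL').
exists (M \co L'); split; last first.
  by rewrite -LY bopC; case: LL' => -> _ _ _.
split; first exact: linear_automorphism_biholomorphic ML.
by exists (M \co L').
Qed.

End Cayley.

Section Symmetry.
Variables (R : realType) (H K : hilbertType R).
Local Notation A := (bop H (dsum K H)).
Implicit Types (Z : A).

Definition product_symmetry (p : bop H K * bop H H) := (- p.1, bop_inv p.2).

Lemma product_symmetryP p :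
  domainD' H K p -> domainD' H K (product_symmetry p).
Proof.
move=> /domainD'E[p1 p2]; apply/domainD'E; rewrite rnormN; split=> //.
exact: invertible_inv.
Qed.

Lemma product_symmetryK p :
  domainD' H K p -> product_symmetry (product_symmetry p) = p.
Proof.
move=> /domainD'E[_ p2]; rewrite /product_symmetry opprK bop_inv_inv//.
by case: p p2.
Qed.

Lemma is_diff_product_symmetry p : invertible_bop p.2 ->
  is_diff p product_symmetry
    (fun h => (- h.1, - (bop_inv p.2 \co h.2 \co bop_inv p.2))).
Proof.
move=> pV; apply: is_diff_pair.
  exact: (@is_diffN _ _ _ fst fst p (is_diff_fst p)).
exact: (@is_diff_comp _ _ _ _ _ _ _ _ p (is_diff_snd p) (is_diff_inv pV)).
Qed.

Definition base_symmetry : A -> A :=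
  @of_product R H K \o (product_symmetry \o @to_product R H K).

Lemma base_symmetry_biholomorphic :
  biholomorphic (domainD H K) (domainD H K) base_symmetry.
Proof.
have f := @biholomorphic_to_product R H K.
have g : biholomorphic (domainD' H K) (domainD H K) (@of_product R H K).
  apply: (@biholomorphic_of_inverse _ _ _ _ _ _ (@to_product R H K)).
  - by move=> p _; exact: (@ex_diff _ _ _ _ _ _ _ (is_diff_of_product p)).
  - by case: f.
  - by move=> p pD; split; [exact: of_productP|exact: of_productK].
  - by move=> Z ZD; split; [exact/to_productP|exact: to_productK].
apply: biholomorphic_comp g; apply: biholomorphic_comp f _.
have sh : holomorphic (domainD' H K) product_symmetry.
  move=> p /domainD'E[_ pV].
  exact: (@ex_diff _ _ _ _ _ _ _ (is_diff_product_symmetry pV)).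
by apply: (biholomorphic_of_inverse sh sh) => p pD; split;
  by [exact: product_symmetryP|exact: product_symmetryK].
Qed.

Lemma base_symmetryK Z : domainD H K Z -> base_symmetry (base_symmetry Z) = Z.
Proof.
move=> ZD; rewrite /base_symmetry /= of_productK; last first.
  by apply: product_symmetryP; exact/to_productP.
by rewrite product_symmetryK ?to_productK//; exact/to_productP.
Qed.

Lemma bop_inv_id : bop_inv (bop_id H) = bop_id H.
Proof. by apply: bop_invE; exact: bop_ext. Qed.

Lemma to_product_base : to_product (base_point H K) = (0, bop_id H).
Proof.
rewrite /to_product /quotient /base_point bottom_block top_block.
by congr (_, _); apply: bop_ext.
Qed.

Lemma base_symmetry_fix : base_symmetry (base_point H K) = base_point H K.
Proof.
rewrite /base_symmetry /= to_product_base /product_symmetry bop_inv_id oppr0.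
by rewrite /of_product; congr block; apply: bop_ext.
Qed.

Lemma is_diff_base_symmetry : is_diff (base_point H K) base_symmetry -%R.
Proof.
set b := base_point H K.
have bV : invertible_bop (bottom_row b).
  by rewrite bottom_block; exact: invertible_id.
have d1 : is_diff b (@to_product R H K) (fun h => (top_row h, bottom_row h)).
  apply: is_diff_eq (is_diff_to_product bV) _; apply/funext => h.
  rewrite /d_to_product top_block bottom_block bop_inv_id; congr (_, _).
  by apply: bop_ext => x; rewrite bopD addr0.
have d2 : is_diff (to_product b) product_symmetry (fun h => (- h.1, - h.2)).
  apply: is_diff_eq (is_diff_product_symmetry _) _ => //; apply/funext => h.
  rewrite to_product_base bop_inv_id; congr (_, - _); exact: bop_ext.
have d3 : is_diff (product_symmetry (to_product b)) (@of_product R H K)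
    (fun h => block h.1 h.2).
  apply: is_diff_eq (is_diff_of_product _) _; apply/funext => h.
  rewrite to_product_base /product_symmetry /d_of_product /= bop_inv_id oppr0.
  by congr (block _ _); apply: bop_ext => x; rewrite bopD addr0.
have d12 := @is_diff_comp _ _ _ _ _ _ _ _ _ d1 d2.
have d := @is_diff_comp _ _ _ _ _ _ _ _ _ d12 d3.
apply: is_diff_eq d _; apply/funext => h; apply: bop_ext => x.
rewrite -[LHS]/(block (- top_row h) (- bottom_row h) x) -[RHS]/(- (h x)).
by rewrite -[in RHS](block_rows h) !blockE.
Qed.

Lemma domainD_symmetric : symmetric_domain (domainD H K).
Proof.
split; first exact: domain_D.
move=> Y YD; have [L [L' [LL' LY]]] := transitive_from_base YD.
have [L'L LK LD L'D] := LL'.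
have Lb := linear_automorphism_biholomorphic LL'.
have L'b := linear_automorphism_biholomorphic (linear_automorphism_sym LL').
exists (L \o (base_symmetry \o L')); split.
- apply: biholomorphic_comp Lb.
  exact: biholomorphic_comp L'b base_symmetry_biholomorphic.
- move=> Z ZD; rewrite /= L'L base_symmetryK ?LK//; exact: L'D.
- by rewrite /= -LY L'L base_symmetry_fix.
- move=> h.
  have d1 := is_diff_bop L' Y.
  have d2 : is_diff (L' Y) base_symmetry -%R.
    by rewrite -LY L'L; exact: is_diff_base_symmetry.
  have d12 := @is_diff_comp _ _ _ _ _ _ _ _ _ d1 d2.
  have d := @is_diff_comp _ _ _ _ _ _ _ _ _ d12 (is_diff_bop L _).
  by rewrite diff_val /= linearN/= LK.
Qed.

End Symmetry.

Theorem proposition11 (R : realType) (H K : hilbertType R) :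
  [/\ symmetric_domain (domainD H K),
      linearly_transitive (domainD H K)
    & holomorphically_equivalent (domainD H K) (domainD' H K)].
Proof.
split; [exact: domainD_symmetric|exact: domainD_linearly_transitive|].
split; [exact: domain_D|exact: domain_D'|].
by exists (@to_product R H K); exact: biholomorphic_to_product.
Qed.
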